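(* Let $T$ be a complete dependent theory with monster model $\mathfrak{C}$ and let $A\subseteq\mathfrak{C}$ be a (small) set. Suppose that the formula $\varphi(x,a)$ divides over $A$, witnessed by an $A$-indiscernible sequence $J$ (in $\mathrm{tp}(a/A)$, with $\{\varphi(x,a'):a'\in J\}$ inconsistent) such that $\mathrm{tp}(J/A)$ is extendible. Assume furthermore that $\mathrm{tp}(a/A)$ is strictly extendible. Then every strict Morley sequence $I$ in $\mathrm{tp}(a/A)$ witnesses dividing, that is, the set $\varphi(x,I)=\{\varphi(x,a'):a'\in I\}$ is inconsistent.
   Context: $T$ is a complete dependent (NIP) first-order theory, $T=T^{eq}$, with monster model $\mathfrak{C}$. A global type is a complete type over $\mathfrak{C}$ (its realizations lie in a larger monster model). Indiscernible sequences are indexed by infinite linear orders without a last element. For sets $A\subseteq B$, a type $p\in S(B)$ is a strictly nondividing extension of $p\restriction A$ if for every $a\models p$: $\mathrm{tp}(a/B)$ does not divide over $A$, and $\mathrm{tp}(B/Aa)$ does not divide over $A$. A type $p\in S(B)$ is strictly free over $A$ if there is a global type $q$ extending $p$ which is a strictly nondividing extension of $p\restriction A$. A type over $A$ is extendible if it has a global extension which does not fork over $A$; a type $p\in S(A)$ is strictly extendible if there is a global type extending $p$ which is strictly free over $A$. A sequence $I=\langle a_i:i\in O\rangle$ is a strict Morley sequence over $A$ if it is indiscernible over $A$ and $\mathrm{tp}(a_i/Aa_{<i})$ is strictly free over $A$ for all $i\in O$, where $a_{<i}=\langle a_j:j<i\rangle$. A strict Morley sequence in $p\in S(A)$ is a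 strict Morley sequence over $A$ of realizations of $p$. *)

(* Defs.v *)
From HB Require Import structures.
From mathcomp Require Import all_boot all_order.
From mathcomp Require Import boolp classical_sets functions cardinality.

Set Implicit Arguments.
Unset Strict Implicit.
Unset Printing Implicit Defensive.

Local Open Scope classical_set_scope.
Local Open Scope card_scope.
Local Open Scope order_scope.

(** * Many-sorted first-order logic *)

Record language := Language {
  lsort : Type;
  funsym : Type;
  far : funsym -> nat;
  fdom : forall f : funsym, 'I_(far f) -> lsort;
  fcod : funsym -> lsort;
  relsym : Type;
  rar : relsym -> nat;
  rdom : forall r : relsym, 'I_(rar r) -> lsort }.

(* A context is a family of sorted variables. It may be infinite, so that types
   of infinite tuples are covered; a formula only uses finitely many of them. *)
Record ctx (L : language) := Ctx { vars : Type; srt : vars -> lsort L }.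

Section Contexts.
Variable L : language.

Definition fctx n (s : 'I_n -> lsort L) : ctx L := Ctx s.
Definition ctx1 (s : lsort L) : ctx L := fctx (fun _ : 'I_1 => s).
Definition ctx0 : ctx L := Ctx (fun v : void => match v with end).

Definition ctx_ext (G : ctx L) (s : lsort L) : ctx L :=
  Ctx (fun v : option (vars G) => if v is Some w then srt w else s).

Definition ctx_cat (G D : ctx L) : ctx L :=
  Ctx (fun v : vars G + vars D =>
         match v with inl w => srt w | inr w => srt w end).

Definition ctx_pow (O : Type) (G : ctx L) : ctx L :=
  Ctx (fun v : O * vars G => srt v.2).

Inductive term (G : ctx L) : lsort L -> Type :=
| Var (v : vars G) : term G (srt v)
| App (f : funsym L) : (forall i, term G (@fdom L f i)) -> term G (fcod f).

Inductive formula (G : ctx L) : Type :=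
| FBot : formula G
| FEq (s : lsort L) : term G s -> term G s -> formula G
| FRel (r : relsym L) : (forall i, term G (@rdom L r i)) -> formula G
| FImp : formula G -> formula G -> formula G
| FAll (s : lsort L) : formula (ctx_ext G s) -> formula G.

Definition FNeg G (phi : formula G) : formula G := FImp phi (FBot G).

End Contexts.

Arguments ctx0 {L}.

Record structure (L : language) := Structure {
  carrier :> lsort L -> Type;
  carrier_inhabited : forall s, inhabited (carrier s);
  interp_func : forall f : funsym L,
    (forall i, carrier (@fdom L f i)) -> carrier (fcod f);
  interp_rel : forall r : relsym L,
    (forall i, carrier (@rdom L r i)) -> Prop }.

Section Semantics.
Variables (L : language) (M : structure L).

Definition tup (G : ctx L) := forall v : vars G, M (srt v).

Definition tup0 : tup ctx0 := fun v => match v with end.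
Definition tup1 s (c : M s) : tup (ctx1 s) := fun _ => c.

Definition tup_ext G s (a : tup G) (c : M s) : tup (ctx_ext G s) :=
  fun v => match v with Some w => a w | None => c end.

Definition tup_cat G D (a : tup G) (b : tup D) : tup (ctx_cat G D) :=
  fun v => match v with inl w => a w | inr w => b w end.

Definition flat (O : Type) G (a : O -> tup G) : tup (ctx_pow O G) :=
  fun v => a v.1 v.2.

Fixpoint eval G (a : tup G) s (t : term G s) : M s :=
  match t with
  | Var v => a v
  | App f ts => interp_func (fun i => eval a (ts i))
  end.

Fixpoint sat G (phi : formula G) : tup G -> Prop :=
  match phi with
  | FBot => fun _ => False
  | FEq _ t u => fun a => eval a t = eval a u
  | FRel _ ts => fun a => interp_rel (fun i => eval a (ts i))
  | FImp phi1 phi2 => fun a => sat phi1 a -> sat phi2 a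
  | FAll _ phi1 => fun a => forall c, sat phi1 (tup_ext a c)
  end.

(* Points carry their sort; subsets of a structure are sets of points. *)
Definition elt := {s : lsort L & M s}.

Definition rng G (a : tup G) : set elt :=
  range (fun v => existT (fun s => M s) (srt v) (a v)).

Definition enum_ctx (B : set elt) : ctx L :=
  Ctx (fun x : {x : elt | B x} => projT1 (sval x)).
Definition enum_tup (B : set elt) : tup (enum_ctx B) :=
  fun x => projT2 (sval x).

Definition automorphism (h : forall s, M s -> M s) : Prop :=
  [/\ forall s, bijective (h s),
      forall (f : funsym L) xs,
        h _ (@interp_func L M f xs) = interp_func (fun i => h _ (xs i))
    & forall (r : relsym L) xs,
        @interp_rel L M r xs <-> interp_rel (fun i => h _ (xs i))].

End Semantics.

Definition elementary_embedding L (C N : structure L)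
    (h : forall s, C s -> N s) : Prop :=
  forall n (s : 'I_n -> lsort L) (phi : formula (fctx s)) (a : tup C (fctx s)),
    sat phi a <-> sat (M := N) phi (fun v => h _ (a v)).

(* The copy of C inside N. *)
Definition universe_of L (C N : structure L) (h : forall s, C s -> N s) :
    set (elt N) :=
  range (fun c : elt C => existT (fun s => N s) (projT1 c) (h _ (projT2 c))).

(** * Theories *)

Section Theories.
Variable L : language.

Definition sentence := formula (@ctx0 L).
Definition theory := set sentence.

Definition models (M : structure L) (T : theory) : Prop :=
  forall sigma, T sigma -> sat sigma (tup0 M).

Definition complete (T : theory) : Prop :=
  (exists M, models M T) /\
  forall sigma : sentence,
    (forall M, models M T -> sat sigma (tup0 M)) \/
    (forall M, models M T -> sat (FNeg sigma) (tup0 M)).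

Definition has_IP (M : structure L) n (s : 'I_n -> lsort L)
    m (t : 'I_m -> lsort L) (phi : formula (ctx_cat (fctx s) (fctx t))) : Prop :=
  exists (a : nat -> tup M (fctx s)) (b : set nat -> tup M (fctx t)),
    forall i w, sat phi (tup_cat (a i) (b w)) <-> w i.

Definition dependent (T : theory) : Prop :=
  forall n (s : 'I_n -> lsort L) m (t : 'I_m -> lsort L)
         (phi : formula (ctx_cat (fctx s) (fctx t))) (M : structure L),
    models M T -> ~ has_IP M phi.

(* T = T^eq: the quotient of a finite product of sorts by a 0-definable
   equivalence relation is, up to 0-definable bijection, a sort; F defines the
   projection. *)
Definition is_eq_closed (T : theory) : Prop :=
  forall n (s : 'I_n -> lsort L) (E : formula (ctx_cat (fctx s) (fctx s))),
    (forall M : structure L, models M T ->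
       RelationClasses.Equivalence
         (fun a b : tup M (fctx s) => sat E (tup_cat a b))) ->
    exists (e : lsort L) (F : formula (ctx_cat (fctx s) (ctx1 e))),
      forall M : structure L, models M T ->
        exists pi : tup M (fctx s) -> M e,
          [/\ forall a c, sat F (tup_cat a (tup1 c)) <-> pi a = c,
              forall c, exists a, pi a = c
            & forall a b, pi a = pi b <-> sat E (tup_cat a b)].

End Theories.

(** * Types *)

Section Types.
Variables (L : language) (M : structure L).

(* A formula in the variables G with a finite tuple of parameters from M. *)
Record pform (G : ctx L) := PForm {
  pf_n : nat;
  pf_s : 'I_pf_n -> lsort L;
  pf_phi : formula (ctx_cat G (fctx pf_s));
  pf_par : tup M (fctx pf_s) }.

Arguments pf_n {G} theta : rename.
Arguments pf_s {G} theta : rename.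
Arguments pf_phi {G} theta : rename.
Arguments pf_par {G} theta : rename.

Variable G : ctx L.
Implicit Types (a : tup M G) (B : set (elt M)) (p : set (pform G)).

Definition pneg (theta : pform G) : pform G :=
  PForm (FNeg (pf_phi theta)) (pf_par theta).

Definition over_params B (theta : pform G) : Prop := rng (pf_par theta) `<=` B.

Definition holds a (theta : pform G) : Prop :=
  sat (pf_phi theta) (tup_cat a (pf_par theta)).

Definition realizes a p : Prop := forall theta, p theta -> holds a theta.

Definition consistent p : Prop :=
  forall F : set (pform G), finite_set F -> F `<=` p -> exists a, realizes a F.

Definition complete_type B p : Prop :=
  [/\ p `<=` over_params B, consistent p
    & forall theta, over_params B theta -> p theta \/ p (pneg theta)].

Definition tp a B : set (pform G) :=
  [set theta | over_params B theta /\ holds a theta].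

End Types.

Arguments pf_n {L M G} theta : rename.
Arguments pf_s {L M G} theta : rename.
Arguments pf_phi {L M G} theta : rename.
Arguments pf_par {L M G} theta : rename.

(** * Monster models *)

(* A cardinal is represented by a type K. *)
Definition card_lt (X : Type) (A : set X) (K : Type) : Prop :=
  A #<= [set: K] /\ ~ ([set: K] #<= A).

Definition saturated (K : Type) L (M : structure L) : Prop :=
  forall (B : set (elt M)) s (p : set (pform M (ctx1 s))),
    card_lt B K -> complete_type B p -> exists a, realizes a p.

Definition strongly_homogeneous (K : Type) L (M : structure L) : Prop :=
  forall (G : ctx L) (a b : tup M G), card_lt [set: vars G] K ->
    (forall phi : formula G, sat phi a <-> sat phi b) ->
    exists h : forall s, M s -> M s,
      automorphism h /\ forall v, h _ (a v) = b v.

Definition monster (K : Type) L (M : structure L) : Prop :=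
  [/\ card_lt [set: (lsort L + funsym L + relsym L + nat)%type] K,
      saturated K M & strongly_homogeneous K M].

(** * Dividing, forking and strict freeness *)

(* N is the larger monster model, and U the universe of the monster model,
   viewed as an elementary substructure of N. A global type is a complete type
   over U, and its realizations are taken in N. *)
Section Dividing.
Variables (L : language) (N : structure L) (U : set (elt N)).
Implicit Types (A B : set (elt N)).

Definition indiscernible A d (O : orderType d) G (I : O -> tup N G) : Prop :=
  [/\ infinite_set [set: O],
      forall i : O, exists j : O, i < j
    & forall n (f g : 'I_n -> O),
        {homo f : i j / i < j} -> {homo g : i j / i < j} ->
        tp (flat (fun i => I (f i))) A = tp (flat (fun i => I (g i))) A].

Definition inst_seq G n (s : 'I_n -> lsort L) (phi : formula (ctx_cat G (fctx s)))
    (O : Type) (I : O -> tup N (fctx s)) : set (pform N G) :=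
  range (fun i => PForm phi (I i)).

Definition witnesses_dividing A G n (s : 'I_n -> lsort L)
    (phi : formula (ctx_cat G (fctx s))) (a : tup N (fctx s))
    d (O : orderType d) (I : O -> tup N (fctx s)) : Prop :=
  [/\ indiscernible A I,
      forall i, realizes (I i) (tp a A)
    & ~ consistent (inst_seq phi I)].

Definition formula_divides A G (theta : pform N G) : Prop :=
  exists I : nat -> tup N (fctx (pf_s theta)),
    witnesses_dividing A (pf_phi theta) (pf_par theta) I.

Definition divides A G (p : set (pform N G)) : Prop :=
  exists theta : pform N G,
    formula_divides A theta /\ forall a, realizes a p -> holds a theta.

Definition forks A G (p : set (pform N G)) : Prop :=
  exists n (theta : 'I_n -> pform N G),
    (forall i, formula_divides A (theta i)) /\
    forall a, realizes a p -> exists i, holds a (theta i).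

Definition global_type G (q : set (pform N G)) : Prop := complete_type U q.

(* p, in S(B), is a strictly nondividing extension of its restriction to A. *)
Definition strictly_nondividing A B G (p : set (pform N G)) : Prop :=
  forall a, realizes a p ->
    ~ divides A (tp a B) /\ ~ divides A (tp (enum_tup (B := B)) (A `|` rng a)).

Definition strictly_free A G (p : set (pform N G)) : Prop :=
  exists q, [/\ global_type q, p `<=` q & strictly_nondividing A U q].

Definition extendible A G (p : set (pform N G)) : Prop :=
  exists q, [/\ global_type q, p `<=` q & ~ forks A q].

Definition strictly_extendible A G (p : set (pform N G)) : Prop :=
  exists q, [/\ global_type q, p `<=` q & strictly_free A q].

Definition strict_Morley A d (O : orderType d) G (I : O -> tup N G) : Prop :=
  indiscernible A I /\
  forall i, strictly_free A
    (tp (I i) (A `|` \bigcup_(j in [set j | j < i]) rng (I j))).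

Definition strict_Morley_in A G (p : set (pform N G))
    d (O : orderType d) (I : O -> tup N G) : Prop :=
  strict_Morley A I /\ forall i, realizes (I i) p.

End Dividing.

(* Main.v *)
(* Let a_0, a_1, ... be an increasing subsequence of I, J a sequence witnessing
   that phi(x, a) divides, and suppose k members of J give an inconsistent set.
   Build an array D whose rows D_i start at a_i and have the type over A of
   initial segments of J read backwards, such that every choice of one entry
   per row gives a sequence with the type of (a_i). Given n rows, let e realize
   the global type q that extends tp(a_n/A a_<n). As tp(C/Ae) does not divide
   over A, a copy D' of D satisfies D' J_j = D e over A for all j; a Morley
   sequence (b_j), over A D' J, of a type finitely satisfiable in J is then a
   new row, indiscernible over A D'. As q does not divide over A, dependence
   implies that it preserves A-indiscernible sequences, so changing entries one
   at a time from the last row on is a chain of steps along A-indiscernible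
   sequences.
   If c satisfies all phi(x, a_i), then each row has an entry which fails at c;
   choosing in each row either a_i or the failing entry shows that every
   pattern of truth values occurs on (phi(x, a_i)), against dependence. *)

From Stdlib Require List.
Require Import Defs.
From mathcomp Require Import all_boot all_order.
From mathcomp Require Import boolp classical_sets functions cardinality filter.

Set Implicit Arguments.
Unset Strict Implicit.
Unset Printing Implicit Defensive.

Local Open Scope classical_set_scope.
Local Open Scope card_scope.

(** * Substitution and finite support *)

Section Substitution.
Variable L : language.
Implicit Types (G D : ctx L).

(** The induction that builds the array cannot rest on equality of types over A: a global type that
    does not divide over A may still separate two tuples of the same type over A. In a dependent
    theory it cannot separate two terms of an A-indiscernible sequence. Branches are therefore
    linked by such sequences, and equality of types is read off only at the end. The two halves of
    strictness act in opposite directions. Nondividing of tp(C/Ae) copies the old rows so that every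
    term of J relates to the copy as e does to the original, which makes room for a new row;
    nondividing of tp(e/C) carries the links between old branches over to their continuations by e.
    Rows run backwards because a coheir sequence is approximated from its last term: that term is
    replaced by a term of J first, and each earlier one by a later term of J. As e lies in N only,
    each step returns to C by saturation, and homogeneity restores the first column. *)

Fixpoint tsub G D (sg : forall v : vars G, term D (srt v)) s (t : term G s) :
    term D s :=
  match t with
  | Var v => sg v
  | App f ts => App (fun i => tsub sg (ts i))
  end.

Definition wk D s r (t : term D r) : term (ctx_ext D s) r :=
  tsub (fun v => Var (Some v : vars (ctx_ext D s))) t.

Definition lift_sub G D (sg : forall v : vars G, term D (srt v)) s :
    forall v : vars (ctx_ext G s), term (ctx_ext D s) (srt v) :=
  fun v => match v with
  | Some w => wk s (sg w)
  | None => Var (None : vars (ctx_ext D s))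
  end.

Fixpoint fsub G (phi : formula G) :
    forall D, (forall v : vars G, term D (srt v)) -> formula D :=
  match phi with
  | FBot => fun D _ => FBot D
  | FEq _ t u => fun D sg => FEq (tsub sg t) (tsub sg u)
  | FRel r ts => fun D sg => FRel (fun i => tsub sg (ts i))
  | FImp p q => fun D sg => FImp (fsub p sg) (fsub q sg)
  | FAll s p => fun D sg => FAll (fsub p (@lift_sub _ _ sg s))
  end.

Lemma funextD (X : Type) (Y : X -> Type) (f g : forall x, Y x) :
  (forall x, f x = g x) -> f = g.
Proof. exact: functional_extensionality_dep. Qed.

Lemma eval_tsub (M : structure L) G D (sg : forall v : vars G, term D (srt v))
    (b : tup M D) s (t : term G s) :
  eval b (tsub sg t) = eval (fun v => eval b (sg v)) t.
Proof. by elim: t => //= f ts IH; congr interp_func; apply: funextD. Qed.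

Lemma sat_fsub (M : structure L) G (phi : formula G) D
    (sg : forall v : vars G, term D (srt v)) (b : tup M D) :
  sat (fsub phi sg) b <-> sat phi (fun v => eval b (sg v)).
Proof.
elim: phi D sg b => {G} [G|G s t u|G r ts|G p IHp q IHq|G s p IH] D sg b //=.
- by rewrite !eval_tsub.
- rewrite (_ : (fun i => _) = (fun i => eval (fun v => eval b (sg v)) (ts i))) //.
  by apply: funextD => i; rewrite eval_tsub.
- by rewrite IHp IHq.
- have E c : (fun v => eval (tup_ext b c) (lift_sub sg v))
           = tup_ext (fun v => eval b (sg v)) c.
    by apply: funextD => -[v|] //=; rewrite /wk eval_tsub.
  by split=> H c; move: (H c); rewrite IH E.
Qed.

Definition same_tp (M M' : structure L) G (x : tup M G) (y : tup M' G) : Prop :=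
  forall phi : formula G, sat phi x <-> sat phi y.

Lemma same_tp_refl (M : structure L) G (x : tup M G) : same_tp x x.
Proof. by []. Qed.

Lemma same_tp_sym (M M' : structure L) G (x : tup M G) (y : tup M' G) :
  same_tp x y -> same_tp y x.
Proof. by move=> H phi; rewrite (H phi). Qed.

Lemma same_tp_trans (M M' M'' : structure L) G (x : tup M G) (y : tup M' G)
    (z : tup M'' G) : same_tp x y -> same_tp y z -> same_tp x z.
Proof. by move=> H1 H2 phi; rewrite (H1 phi). Qed.

Lemma same_tp_imp (M M' : structure L) G (x : tup M G) (y : tup M' G) :
  (forall phi : formula G, sat phi x -> sat phi y) -> same_tp x y.
Proof.
move=> H phi; split; first exact: H.
move=> Hy; apply: contrapT => Hx.
by have := H (FNeg phi) Hx; apply.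
Qed.

(** Coordinates are picked by terms rather than by a map of variables: a term already has the right
    sort, so no equation between sorts has to be transported. Most uses drop or permute
    coordinates. *)
Lemma same_tp_ren (M M' : structure L) G D (x : tup M G) (y : tup M' G)
    (x' : tup M D) (y' : tup M' D) :
  same_tp x y ->
  (forall v : vars D, exists t : term G (srt v), eval x t = x' v /\ eval y t = y' v) ->
  same_tp x' y'.
Proof.
move=> xy /(_ _)/cid H phi.
pose sg v := sval (H v).
have -> : x' = fun v => eval x (sg v).
  by apply: funextD => v; case: (svalP (H v)).
have -> : y' = fun v => eval y (sg v).
  by apply: funextD => v; case: (svalP (H v)).
by rewrite -!sat_fsub; apply: xy.
Qed.

(** [Z] packs the data on which both tuples depend, so that one formula serves all structures and
    all data at once. *)
Lemma fsub_exists G D (phi : formula G) (Z : structure L -> Type)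
    (y : forall M, Z M -> tup M D) (x : forall M, Z M -> tup M G) :
  (forall v : vars G, exists t : term D (srt v),
     forall (M : structure L) (z : Z M), eval (y M z) t = x M z v) ->
  exists psi : formula D, forall (M : structure L) (z : Z M),
    sat psi (y M z) <-> sat phi (x M z).
Proof.
move=> /(_ _)/cid H; exists (fsub phi (fun v => sval (H v))) => M z.
rewrite sat_fsub (_ : (fun v => _) = x M z) //.
by apply: funextD => v; rewrite (svalP (H v)).
Qed.

Definition FAnd G (p q : formula G) := FNeg (FImp p (FNeg q)).
Definition FEx G s (p : formula (ctx_ext G s)) := FNeg (FAll (FNeg p)).

Lemma sat_neg (M : structure L) G (p : formula G) (a : tup M G) :
  sat (FNeg p) a <-> ~ sat p a.
Proof. by []. Qed.

Lemma sat_and (M : structure L) G (p q : formula G) (a : tup M G) :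
  sat (FAnd p q) a <-> sat p a /\ sat q a.
Proof.
rewrite /=; split; last by move=> [Hp Hq]; apply.
by move=> H; split; apply: contrapT => H'; apply: H.
Qed.

Lemma sat_ex (M : structure L) G s (p : formula (ctx_ext G s)) (a : tup M G) :
  sat (FEx p) a <-> exists c : M s, sat p (tup_ext a c).
Proof.
rewrite /=; split=> [H|[c Hc] H]; last exact: (H c).
by apply: contrapT => H'; apply: H => c Hc; apply: H'; exists c.
Qed.

Definition FTop G : formula G := FNeg (FBot G).

Definition sub_ctx G (X : Type) (f : X -> vars G) : ctx L := Ctx (fun i => srt (f i)).

Definition tup_sub (M : structure L) G X (f : X -> vars G) (a : tup M G) :
  tup M (sub_ctx f) := fun i => a (f i).
Arguments tup_sub {M G X} f a.

Lemma term_support G s (t : term G s) :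
  exists (X : finType) (f : X -> vars G) (t' : term (sub_ctx f) s),
    forall (M : structure L) (a : tup M G), eval a t = eval (tup_sub f a) t'.
Proof.
elim: t => [v|g ts IH].
  exists unit, (fun _ => v), (Var (tt : vars (sub_ctx (fun _ : unit => v)))).
  by [].
have {IH} /(_ _)/cid IH := IH.
pose X := {i : 'I_(far g) & sval (IH i)}.
have IH2 i := cid (svalP (IH i)).
have IH3 i := cid (svalP (IH2 i)).
pose f (x : X) : vars G := sval (IH2 (tag x)) (tagged x).
exists X, f, (App (f := g) (fun i => @tsub (sub_ctx (sval (IH2 i))) (sub_ctx f)
  (fun v : sval (IH i) => Var (Tagged (fun i => sval (IH i)) v : vars (sub_ctx f)))
  _ (sval (IH3 i)))) => M a /=.
by congr interp_func; apply: funextD => i; rewrite eval_tsub (svalP (IH3 i)).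
Qed.

Lemma formula_support G (phi : formula G) :
  exists (X : finType) (f : X -> vars G) (phi' : formula (sub_ctx f)),
    forall (M : structure L) (a : tup M G), sat phi a <-> sat phi' (tup_sub f a).
Proof.
elim: phi => {G} [G|G s t u|G r ts|G p IHp q IHq|G s p IH].
- exists void, (fun v : void => match v with end), (FBot _) => //.
- have [X [f [t' Ht]]] := term_support t; have [Y [g [u' Hu]]] := term_support u.
  pose h (z : X + Y) := match z with inl x => f x | inr y => g y end.
  exists (X + Y)%type, h, (FEq
    (@tsub (sub_ctx f) _ (fun x : X => Var (inl x : vars (sub_ctx h))) _ t')
    (@tsub (sub_ctx g) _ (fun y : Y => Var (inr y : vars (sub_ctx h))) _ u')) => M a /=.
  by rewrite !eval_tsub Ht Hu.
- have /(_ _)/cid IH := fun i => term_support (ts i).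
  pose X := {i : 'I_(rar r) & sval (IH i)}.
  have IH2 i := cid (svalP (IH i)).
  have IH3 i := cid (svalP (IH2 i)).
  pose f (x : X) : vars G := sval (IH2 (tag x)) (tagged x).
  exists X, f, (FRel (r := r) (fun i => @tsub (sub_ctx (sval (IH2 i))) (sub_ctx f)
    (fun v : sval (IH i) => Var (Tagged (fun i => sval (IH i)) v : vars (sub_ctx f)))
    _ (sval (IH3 i)))) => M a /=.
  rewrite (_ : (fun i => eval a (ts i)) = (fun i => eval (tup_sub f a) (@tsub (sub_ctx (sval (IH2 i))) (sub_ctx f)
    (fun v : sval (IH i) => Var (Tagged (fun i => sval (IH i)) v : vars (sub_ctx f)))
    _ (sval (IH3 i))))) //.
  by apply: funextD => i; rewrite eval_tsub (svalP (IH3 i)).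
- have [X [f [p' Hp]]] := IHp; have [Y [g [q' Hq]]] := IHq.
  pose h (z : X + Y) := match z with inl x => f x | inr y => g y end.
  exists (X + Y)%type, h, (FImp
    (@fsub (sub_ctx f) p' (sub_ctx h) (fun x : X => Var (inl x : vars (sub_ctx h))))
    (@fsub (sub_ctx g) q' (sub_ctx h) (fun y : Y => Var (inr y : vars (sub_ctx h))))) => M a /=.
  by rewrite !sat_fsub Hp Hq.
- have [X [f [p' Hp]]] := IH.
  (* The bound variable [None] may lie in the support of the body and has to be removed. Its places
     receive a default variable of [G]; if [G] has none, the support is empty. *)
  have [Y [g Hg]] : exists (Y : finType) (g : Y -> vars G),
      forall x w, f x = Some w -> exists y, g y = w.
    have [[w0]|no] := EM (inhabited (vars G)).
      by exists X, (fun x => odflt w0 (f x)) => x w E; exists x; rewrite E.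
    exists void, (fun v : void => match v with end) => x w; case: no; exact: (inhabits w).
  have [|psi Hpsi] := @fsub_exists _ (ctx_ext (sub_ctx g) s) p'
    (fun M => tup M G * M s)%type
    (fun M z => @tup_ext _ _ (sub_ctx g) _ (fun i => z.1 (g i)) z.2)
    (fun M z i => tup_ext z.1 z.2 (f i)); last first.
    exists Y, g, (FAll psi) => M a /=.
    by split=> H c; move: (H c); rewrite (Hpsi M (a, c)) Hp.
  move=> x /=; case E: (f x) => [w|].
    have [y <-] := Hg _ _ E.
    by exists (Var (Some y : vars (ctx_ext (sub_ctx g) s))).
  by exists (Var (None : vars (ctx_ext (sub_ctx g) s))).
Qed.

(** A [pform] takes parameters indexed by some ['I_n]; this brings a formula with an infinite
    parameter tuple into that shape. *)
Lemma formula_support_right G' G (psi : formula (ctx_cat G' G)) :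
  exists n (f : 'I_n -> vars G) (psi' : formula (ctx_cat G' (sub_ctx f))),
    forall (M : structure L) (x : tup M G') (y : tup M G),
      sat psi (tup_cat x y) <-> sat psi' (tup_cat x (tup_sub f y)).
Proof.
have [X [f [p' Hp]]] := formula_support psi.
have [n [g Hg]] : exists n (g : 'I_n -> vars G),
    forall x w, f x = inr w -> exists y, g y = w.
  have [[w0]|no] := EM (inhabited (vars G)).
    exists #|X|, (fun i => if f (enum_val i) is inr w then w else w0) => x w E.
    by exists (enum_rank x); rewrite enum_rankK E.
  by exists 0, (fun i : 'I_0 => False_rect _ (notF (ltn_ord i))) => x w; case: no; exact: (inhabits w).
exists n, g.
have [|psi' Hpsi] := @fsub_exists _ (ctx_cat G' (sub_ctx g)) p'
    (fun M => tup M G' * tup M G)%type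
    (fun M z => tup_cat z.1 (tup_sub g z.2))
    (fun M z i => tup_cat z.1 z.2 (f i)); last first.
  by exists psi' => M x y; rewrite Hp (Hpsi M (x, y)).
move=> x /=; case E: (f x) => [w|w] /=.
  by exists (Var (inl w : vars (ctx_cat G' (sub_ctx g)))).
have [y <-] := Hg _ _ E.
by exists (Var (inr y : vars (ctx_cat G' (sub_ctx g)))).
Qed.

End Substitution.

Arguments tup_sub {L M G X} f a.

(** * Small cardinals *)

Section Cardinals.

Lemma inj_card_leT (X Y : Type) (f : X -> Y) :
  injective f -> [set: X] #<= [set: Y].
Proof.
move=> fI.
have [g] : $|{injfun [set: X] >-> [set: Y]}|.
  by apply/injfunPex; exists f => // x y _ _; exact: fI.
exact: inj_card_le.
Qed.

Lemma card_leT_inj (X Y : Type) :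
  [set: X] #<= [set: Y] -> exists f : X -> Y, injective f.
Proof.
move=> /card_leP[f].
exists (fun x => val (f (SigSub (mem_set (I : [set: X] x))))) => x y /val_inj E.
have : SigSub (mem_set (I : [set: X] x)) = SigSub (mem_set (I : [set: X] y)).
  by apply: (@inj _ _ _ f); rewrite ?in_setT.
by move=> /(congr1 val).
Qed.

Lemma card_le_lt (X Y K : Type) (A : set X) (B : set Y) :
  A #<= B -> card_lt B K -> card_lt A K.
Proof.
move=> AB [BK KB]; split; first exact: card_le_trans AB BK.
by move=> KA; apply: KB; apply: card_le_trans KA AB.
Qed.

Lemma card_sig (X : Type) (A : set X) : [set: {x | A x}] #<= A.
Proof.
have [g] : $|{injfun [set: {x | A x}] >-> A}|.
  apply/injfunPex; exists sval => [[x Ax] //|[x Ax] [y Ay] _ _ /= E].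
  by move: Ay; rewrite -E => Ay; congr exist; exact: Prop_irrelevance.
exact: inj_card_le.
Qed.

Lemma card_lt_sig (X K : Type) (A : set X) : card_lt A K -> card_lt [set: {x | A x}] K.
Proof. exact/card_le_lt/card_sig. Qed.

Lemma card_le_range (X Y : Type) (f : X -> Y) : range f #<= [set: X].
Proof. exact: card_image_le. Qed.

Definition countable_type (X : Type) := exists f : X -> nat, injective f.

(* An infinite set absorbs a countable one. *)
Lemma card_lt_countable_sum (X Y K : Type) :
  card_lt [set: nat] K -> countable_type Y -> card_lt [set: X] K ->
  card_lt [set: (Y + X)%type] K.
Proof.
move=> natK [g gI] XK.
have [fX|/infiniteP/card_leT_inj[h hI]] := EM (finite_set [set: X]).
  apply: card_le_lt natK.
  have [f fI] := card_leT_inj (finite_set_countable fX).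
  apply: (@inj_card_leT _ _ (fun z => match z with
    | inl y => (g y).*2 | inr x => (f x).*2.+1 end)).
  move=> [y|x] [y'|x'] /=.
  - by move=> /double_inj/gI ->.
  - by move=> /(congr1 odd); rewrite /= !odd_double.
  - by move=> /(congr1 odd); rewrite /= !odd_double.
  - by move=> [/double_inj/fI ->].
apply: card_le_lt XK.
(* Hilbert's hotel: the points [h n] move to the even places and [Y] is sent to the odd ones. *)
pose F z := match z with
  | inl y => h (g y).*2.+1
  | inr x => match pselect (exists n, h n = x) with
             | left e => h (sval (cid e)).*2 | right _ => x end end.
apply: (@inj_card_leT _ _ F) => z z'.
have E n (e : exists k, h k = h n) : sval (cid e) = n by apply: hI; exact: svalP (cid e).
have Fr x : (exists2 n, x = h n & F (inr x) = h n.*2) \/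
            (~ (exists n, h n = x) /\ F (inr x) = x).
  rewrite /F; case: pselect => [e|ne]; last by right.
  by case: (e) => n xn; left; exists n => //; subst x; rewrite E.
case: z z' => [y|x] [y'|x'].
- by move=> /hI[/double_inj/gI ->].
- have [[n -> ->]|[ne ->]] := Fr x' => /=; last by move=> H; case: ne; eexists; exact: H.
  by move=> /hI/(congr1 odd); rewrite /= !odd_double.
- have [[n -> ->]|[ne ->]] := Fr x => /=; last by move=> H; case: ne; eexists; symmetry; exact: H.
  by move=> /hI/(congr1 odd); rewrite /= !odd_double.
- have [[n -> ->]|[ne ->]] := Fr x; have [[n' -> ->]|[ne' ->]] := Fr x'.
  + by move=> /hI/double_inj ->.
  + by move=> H; case: ne'; eexists; exact: H.
  + by move=> H; case: ne; eexists; symmetry; exact: H.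
  + by move=> ->.
Qed.

Lemma countable_countType (X : countType) : countable_type X.
Proof. by exists pickle; exact: pcan_inj (@pickleK X). Qed.

Lemma countable_sub (X : Type) (A : X -> Prop) :
  countable_type X -> countable_type {x | A x}.
Proof.
move=> [f fI]; exists (f \o sval) => -[x Ax] [y Ay] /= /fI E.
by move: Ay; rewrite -E => Ay; congr exist; exact: Prop_irrelevance.
Qed.

Lemma countable_prod (X Y : Type) :
  countable_type X -> countable_type Y -> countable_type (X * Y).
Proof.
move=> [f fI] [g gI]; exists (fun z => pickle (f z.1, g z.2)) => -[x y] [x' y'].
by move=> /(pcan_inj (@pickleK _)) [/fI -> /gI ->].
Qed.

End Cardinals.

(** * Finite sets as lists *)

Section Lists.

Lemma In_mem (T : eqType) (l : seq T) x : x \in l -> List.In x l.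
Proof. by elim: l => //= y l IH; rewrite in_cons => /predU1P[->|/IH]; [left|right]. Qed.

Lemma finite_set_In (T : Type) (A : set T) :
  finite_set A -> exists l : seq T, forall x, A x -> List.In x l.
Proof.
move=> /(@finite_seqP {classic T})[s ->]; exists s => x /=; exact: (@In_mem {classic T}).
Qed.

Lemma In_filter (T : Type) (P : pred T) (l : seq T) x :
  List.In x l -> P x -> List.In x [seq y <- l | P y].
Proof.
elim: l => //= y l IH [->|xl] Px; first by rewrite Px; left.
by case: (P y); [right|]; apply: IH.
Qed.

End Lists.

(** * Formulas with parameters from an arbitrary tuple *)

Section FormulasWithParameters.
Variable L : language.

Lemma pform_formula (M : structure L) G' G (y : tup M G) (theta : pform M G') :
  over_params (rng y) theta ->
  exists psi : formula (ctx_cat G' G), forall c : tup M G',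
    holds c theta <-> sat psi (tup_cat c y).
Proof.
move=> th.
have /(_ _)/cid H : forall v : vars (ctx_cat G' (fctx (pf_s theta))),
    exists t : term (ctx_cat G' G) (srt v), forall c : tup M G',
      eval (tup_cat c y) t = tup_cat c (pf_par theta) v.
  move=> [w|i]; first by exists (Var (inl w : vars (ctx_cat G' G))).
  have [w _ E] : rng y (existT (fun s => M s) _ (pf_par theta i)).
    by apply: th; exists i.
  (* [E] equates points together with their sorts. Stated through both projections of the point, the
     goal lets one rewriting change sort and value together. *)
  suff : exists t : term (ctx_cat G' G) (projT1 (existT (fun s => M s) _ (pf_par theta i))),
      forall c : tup M G',
        eval (tup_cat c y) t = projT2 (existT (fun s => M s) _ (pf_par theta i)).
    by move=> [t Ht]; exists t => c; exact: Ht.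
  by rewrite -E; exists (Var (inr w : vars (ctx_cat G' G))).
exists (fsub (pf_phi theta) (fun v => sval (H v))) => c.
rewrite sat_fsub /holds (_ : (fun v => _) = tup_cat c (pf_par theta)) //.
by apply: funextD => v; exact: (svalP (H v)).
Qed.


Lemma formula_pform (M : structure L) G' G (psi : formula (ctx_cat G' G)) (y : tup M G) :
  exists theta : pform M G', over_params (rng y) theta /\
    forall c : tup M G', holds c theta <-> sat psi (tup_cat c y).
Proof.
have [n [f [psi' H]]] := formula_support_right psi.
exists (@PForm L M G' n (fun i => srt (f i)) psi' (tup_sub f y)); split.
  by move=> _ [i _ <-]; exists (f i).
by move=> c; rewrite (H M c y).
Qed.

(** An elementary embedding is defined by tuples indexed by ordinals; finite support carries its
    property to all contexts. *)
Lemma elementary_same_tp (C N : structure L) (emb : forall s, C s -> N s) G (a : tup C G) :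
  elementary_embedding emb -> same_tp a (fun v => emb _ (a v) : N _).
Proof.
move=> emb_elem phi.
have [X [f [phi' H]]] := formula_support phi.
pose f' (i : 'I_#|X|) := f (enum_val i).
have [|psi Hpsi] := @fsub_exists _ _ (sub_ctx f') phi'
    (fun M => tup M G) (fun M a => tup_sub f' a) (fun M a => tup_sub f a).
  move=> x; have [j <-] : exists j : 'I_#|X|, enum_val j = x.
    by exists (enum_rank (x : X)); rewrite enum_rankK.
  by exists (Var (j : vars (sub_ctx f'))).
by rewrite !H -!Hpsi; exact: (emb_elem #|X| (fun i => srt (f' i)) psi (tup_sub f' a)).
Qed.

End FormulasWithParameters.

(** * Saturation and ultrafilters *)

Section Saturation.
Variable L : language.

Definition small_ctx (K : Type) (G : ctx L) := card_lt [set: vars G] K.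

Definition finite_ctx (H : ctx L) :=
  exists (X : finType) (g : X -> vars H), forall v, exists x, g x = v.

Lemma finite_ctx_countable (H : ctx L) : finite_ctx H -> countable_type (vars H).
Proof.
move=> [X [g /(_ _)/cid gS]]; exists (fun v => pickle (sval (gS v))).
move=> v w /(pcan_inj (@pickleK _)) E.
by rewrite -(svalP (gS v)) E (svalP (gS w)).
Qed.

Lemma finite_ctx_fin (X : finType) (f : X -> lsort L) : finite_ctx (Ctx f).
Proof. by exists X, id => v; exists v. Qed.

Lemma finite_ctx_pow (X : finType) (G : ctx L) : finite_ctx G -> finite_ctx (ctx_pow X G).
Proof.
move=> [Y [g gS]]; exists (X * Y)%type, (fun z => (z.1, g z.2)) => -[x v].
by have [y <-] := gS v; exists (x, y).
Qed.

Lemma finite_ctx_cat (G G' : ctx L) : finite_ctx G -> finite_ctx G' -> finite_ctx (ctx_cat G G').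
Proof.
move=> [X [f fS]] [Y [g gS]].
exists (X + Y)%type, (fun z => match z with inl x => inl (f x) | inr y => inr (g y) end).
by move=> [v|v]; [have [x <-] := fS v; exists (inl x)|have [x <-] := gS v; exists (inr x)].
Qed.

(** [y] realizes the limit along [F] of the types of the tuples [Y w]. One implication suffices: for
    an ultrafilter, negation gives the converse. *)
Definition ultra_tp (M M' : structure L) (Om : Type) (F : set_system Om) G
    (Y : Om -> tup M G) (y : tup M' G) : Prop :=
  forall psi : formula G, F [set w | sat psi (Y w)] -> sat psi y.

Lemma ultra_tpE (M M' : structure L) (Om : Type) (F : set_system Om) G
    (Y : Om -> tup M G) (y : tup M' G) (psi : formula G) :
  UltraFilter F -> ultra_tp F Y y -> sat psi y <-> F [set w | sat psi (Y w)].
Proof.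
move=> FU Yy; split; last exact: Yy.
move=> Hy; have [//|H] := in_ultra_setVsetC [set w | sat psi (Y w)] FU.
by have := Yy (FNeg psi) H Hy.
Qed.

Lemma ultra_tp_ren (M M' : structure L) (Om : Type) (F : set_system Om) G D
    (Y : Om -> tup M G) (y : tup M' G) (Y' : Om -> tup M D) (y' : tup M' D) :
  UltraFilter F -> ultra_tp F Y y ->
  (forall v : vars D, exists t : term G (srt v),
     (forall w, eval (Y w) t = Y' w v) /\ eval y t = y' v) ->
  ultra_tp F Y' y'.
Proof.
move=> FU Yy /(_ _)/cid H phi.
pose sg v := sval (H v).
have -> : y' = fun v => eval y (sg v).
  by apply: funextD => v; case: (svalP (H v)).
rewrite -!sat_fsub => HF; apply: Yy; apply: filterS HF => w /=.
rewrite sat_fsub (_ : (fun v => _) = Y' w) //.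
by apply: funextD => v; case: (svalP (H v)).
Qed.

Variables (K : Type) (M' : structure L).
Hypotheses (natK : card_lt [set: nat] K) (satM : saturated K M').

(** The limit type of [z w] over [Y w], transported to [y], is complete because [F] is an
    ultrafilter, and finitely satisfiable because [y] satisfies each existential formula that holds
    on a large set. The choice of [F] decides the use: a principal one amalgamates types, one on
    tuples realizes partial types, a nonprincipal one on [nat] gives coheirs. *)
Lemma ultra_ext (M : structure L) (Om : Type) (F : set_system Om) G
    (Y : Om -> tup M G) (y : tup M' G) s (z : Om -> M s) :
  UltraFilter F -> small_ctx K G -> ultra_tp F Y y ->
  exists e : M' s, ultra_tp F (fun w => tup_ext (Y w) (z w)) (tup_ext y e).
Proof.
move=> FU smallG Yy.
have swap1 (psi : formula (ctx_cat (ctx1 s) G)) :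
    exists psi' : formula (ctx_ext G s), forall (N : structure L) (u : tup N G) (c : N s),
      sat psi' (tup_ext u c) <-> sat psi (tup_cat (tup1 c) u).
  have [|psi' H] := @fsub_exists _ _ (ctx_ext G s) psi (fun N => tup N G * N s)%type
    (fun N u => tup_ext u.1 u.2) (fun N u => tup_cat (tup1 u.2) u.1).
    move=> [v|v]; first by exists (Var (None : vars (ctx_ext G s))).
    by exists (Var (Some v : vars (ctx_ext G s))).
  by exists psi' => N u c; rewrite (H N (u, c)).
have swap2 (psi : formula (ctx_ext G s)) :
    exists psi' : formula (ctx_cat (ctx1 s) G), forall (N : structure L) (u : tup N G) (c : N s),
      sat psi' (tup_cat (tup1 c) u) <-> sat psi (tup_ext u c).
  have [|psi' H] := @fsub_exists _ _ (ctx_cat (ctx1 s) G) psi (fun N => tup N G * N s)%type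
    (fun N u => tup_cat (tup1 u.2) u.1) (fun N u => tup_ext u.1 u.2).
    move=> [v|]; first by exists (Var (inr v : vars (ctx_cat (ctx1 s) G))).
    by exists (Var (inl ord0 : vars (ctx_cat (ctx1 s) G))).
  by exists psi' => N u c; rewrite (H N (u, c)).
have tup1E (a : tup M' (ctx1 s)) : a = tup1 (a ord0).
  by apply: funextD => i; rewrite (ord1 i).
pose large (psi : formula (ctx_ext G s)) := F [set w | sat psi (tup_ext (Y w) (z w))].
(* Membership by implication avoids fixing a formula [psi] for each [th], whose parameters may occur
   at several places of [y]. *)
pose p : set (pform M' (ctx1 s)) := [set th | over_params (rng y) th /\
  exists psi : formula (ctx_ext G s), large psi /\
    forall c : M' s, sat psi (tup_ext y c) -> holds (tup1 c) th].
have [| |a Ha] := satM (B := rng y) (p := p).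
- exact: card_le_lt (card_le_range _) smallG.
- split; first by move=> th [].
  + move=> F0 /finite_set_In[l Hl] F0p.
    have {Hl} Hl th : F0 th -> List.In th [seq th <- l | `[< F0 th >]].
      by move=> F0th; apply: In_filter (Hl _ F0th) _; apply/asboolP.
    have : exists psi, large psi /\ forall c : M' s, sat psi (tup_ext y c) ->
        forall th, List.In th [seq th <- l | `[< F0 th >]] -> holds (tup1 c) th.
      elim: (l) => [|th l' [psi [Hpsi IH]]] /=.
        exists (FTop _); split=> //; by apply: filterS filterT => w _ /=.
      case: asboolP => [/F0p[_ [psi' [Hpsi' H']]]|_]; last by exists psi.
      exists (FAnd psi psi'); split.
        apply: filterS (filterI Hpsi Hpsi') => w [Hw Hw']; exact/sat_and.
      by move=> c /sat_and[Hc Hc'] th' /=[<-|]; [exact: H'|exact: IH].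
    move=> [psi [Hpsi H]].
    have /Yy/sat_ex[c Hc] : F [set w | sat (FEx psi) (Y w)].
      by apply: filterS Hpsi => w Hw; apply/sat_ex; exists (z w).
    by exists (tup1 c) => th F0th; apply: H (Hl _ F0th).
  + move=> th Bth; have [psi Hpsi] := pform_formula Bth.
    have [psi' H'] := swap1 psi.
    have [H|H] := in_ultra_setVsetC [set w | sat psi' (tup_ext (Y w) (z w))] FU.
      by left; split=> //; exists psi'; split=> // c; rewrite H' -Hpsi.
    right; split=> //; exists (FNeg psi'); split=> // c Hc Hth.
    have : sat psi' (tup_ext y c) by rewrite H' -Hpsi.
    exact: Hc.
exists (a ord0) => psi Hpsi.
have [psi' H'] := swap2 psi; have [th [Bth Hth]] := formula_pform psi' y.
rewrite -H' -Hth -tup1E; apply: Ha; split=> //; exists psi; split=> // c.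
by rewrite Hth H'.
Qed.

Lemma ultra_ext_tuple (M : structure L) (Om : Type) (F : set_system Om) G
    (Y : Om -> tup M G) (y : tup M' G) (H : ctx L) (z : Om -> tup M H) :
  UltraFilter F -> small_ctx K G -> ultra_tp F Y y -> finite_ctx H ->
  exists e : tup M' H, ultra_tp F (fun w => tup_cat (z w) (Y w)) (tup_cat e y).
Proof.
move=> FU smallG Yy finH.
have cH := finite_ctx_countable finH.
pose inl_ (l : seq (vars H)) (v : {v | List.In v l}) : vars H := sval v.
have step (l : seq (vars H)) : exists e : tup M' H,
    ultra_tp F (fun w => tup_cat (tup_sub (@inl_ l) (z w)) (Y w)) (tup_cat (tup_sub (@inl_ l) e) y).
  elim: l => [|v0 l [e IH]].
    exists (fun v => sval (cid (let: inhabits c := carrier_inhabited M' (srt v) in ex_intro (fun=> True) c I))).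
    apply: ultra_tp_ren Yy _ => -[[v []]|v]; by exists (Var v).
  have [v0l|v0l] := EM (List.In v0 l).
    exists e; apply: ultra_tp_ren IH _ => -[[v vl]|v]; last first.
      by exists (Var (inr v : vars (ctx_cat (sub_ctx (@inl_ l)) G))).
    have vl' : List.In v l by case: vl => [<-|].
    by exists (Var (inl (exist _ v vl') : vars (ctx_cat (sub_ctx (@inl_ l)) G))).
  have [|c Hc] := ultra_ext (fun w => z w v0) FU _ IH.
    by apply: card_lt_countable_sum => //; exact: countable_sub.
  pose e' v := if pselect (v0 = v) is left E then eq_rect _ (fun v => M' (srt v)) c _ E else e v.
  exists e'; apply: ultra_tp_ren Hc _ => -[[v vl]|v]; last first.
    by exists (Var (Some (inr v) : vars (ctx_ext (ctx_cat (sub_ctx (@inl_ l)) G) _))).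
  have [E|vv0] := EM (v0 = v).
    subst v; exists (Var (None : vars (ctx_ext (ctx_cat (sub_ctx (@inl_ l)) G) (srt v0)))).
    split=> //=; rewrite /tup_sub /e' /=; case: pselect => // E.
    by rewrite (Prop_irrelevance E erefl).
  have vl' : List.In v l by case: vl.
  exists (Var (Some (inl (exist _ v vl')) : vars (ctx_ext (ctx_cat (sub_ctx (@inl_ l)) G) (srt v0)))).
  by split=> //=; rewrite /tup_sub /e' /=; case: pselect.
have [X [g gS]] := finH.
have [e He] := step [seq g x | x <- enum X].
exists e; apply: ultra_tp_ren He _ => -[v|v]; last first.
  by exists (Var (inr v : vars (ctx_cat (sub_ctx (@inl_ [seq g x | x <- enum X])) G))).
have vl : List.In v [seq g x | x <- enum X].
  by have [x <-] := gS v; apply: List.in_map; apply: In_mem; rewrite mem_enum.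
by exists (Var (inl (exist _ v vl) : vars (ctx_cat (sub_ctx (@inl_ [seq g x | x <- enum X])) G))).
Qed.

Lemma same_tp_amalgam (M : structure L) G (x : tup M G) (y : tup M' G) (H : ctx L) (z : tup M H) :
  small_ctx K G -> finite_ctx H -> same_tp x y ->
  exists e : tup M' H, same_tp (tup_cat z x) (tup_cat e y).
Proof.
move=> smallG finH xy; have FU := principal_filter_ultra tt.
have [|e He] := @ultra_ext_tuple M unit _ G (fun=> x) y H (fun=> z) FU smallG _ finH.
  by move=> psi /principal_filterP /= /xy.
by exists e; apply: same_tp_imp => psi Hpsi; apply: He; exact/principal_filterP.
Qed.

(** [saturated] concerns complete types in one variable. Here the solution sets of the finite parts
    of [p] generate a filter on tuples; the limit of the identity along an ultrafilter above it,
    over the constant [y], realizes [p]. *)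
Lemma saturated_realizes (H G : ctx L) (y : tup M' G) (p : set (formula (ctx_cat H G))) :
  small_ctx K G -> finite_ctx H ->
  (forall l : seq (formula (ctx_cat H G)), (forall psi, List.In psi l -> p psi) ->
     exists x : tup M' H, forall psi, List.In psi l -> sat psi (tup_cat x y)) ->
  exists x : tup M' H, forall psi, p psi -> sat psi (tup_cat x y).
Proof.
move=> smallG finH fs.
pose F0 : set_system (tup M' H) := [set S | exists l : seq (formula (ctx_cat H G)),
  (forall psi, List.In psi l -> p psi) /\
  forall x : tup M' H, (forall psi, List.In psi l -> sat psi (tup_cat x y)) -> S x].
have F0P : ProperFilter F0.
  apply: Build_ProperFilter_ex.
    by move=> S [l [lp lS]]; have [x Hx] := fs l lp; exists x; exact: lS.
  split.
  - by exists [::].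
  - move=> S S' [l [lp lS]] [l' [lp' lS']]; exists (l ++ l'); split.
      by move=> psi /(List.in_app_or l l')[/lp|/lp'].
    by move=> x Hx; split; [apply: lS|apply: lS'] => psi Hpsi; apply: Hx;
      apply: (List.in_or_app l l'); [left|right].
  - by move=> S S' SS' [l [lp lS]]; exists l; split=> // x /lS/SS'.
have [F [FU F0F]] := ultraFilterLemma F0P.
have [|e He] := @ultra_ext_tuple M' _ F G (fun=> y) y H id FU smallG _ finH.
  by move=> psi Hpsi; have [] := filter_ex Hpsi.
exists e => psi ppsi; apply: He; apply: F0F; exists [:: psi]; split.
  by move=> _ [<-|[]].
by move=> x; apply; left.
Qed.

End Saturation.

(** * Automorphisms, indiscernible sequences, dependence *)

Section Automorphisms.
Variables (L : language) (M : structure L) (h : forall s, M s -> M s).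
Hypothesis h_aut : automorphism h.

Definition tup_map G (a : tup M G) : tup M G := fun v => h (a v).

Lemma eval_aut G (a : tup M G) s (t : term G s) : h (eval a t) = eval (tup_map a) t.
Proof.
have [_ hf _] := h_aut; elim: t => //= f ts IH.
by rewrite hf; congr interp_func; apply: funextD.
Qed.

Lemma sat_aut G (phi : formula G) (a : tup M G) : sat phi a <-> sat phi (tup_map a).
Proof.
have [hb hf hr] := h_aut.
elim: phi a => {G} [G|G s t u|G r ts|G p IHp q IHq|G s p IH] a //=.
- by rewrite -!eval_aut; split=> [->//|]; apply: bij_inj.
- rewrite hr (_ : (fun i => h _) = (fun i => eval (tup_map a) (ts i))) //.
  by apply: funextD => i; rewrite eval_aut.
- by rewrite IHp IHq.
- have E c : tup_map (tup_ext a c) = tup_ext (tup_map a) (h c).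
    by apply: funextD => -[].
  split=> H c; last by rewrite IH E.
  by have [g gK Kg] := hb s; rewrite -[c]Kg -E -IH.
Qed.

Lemma same_tp_aut G (a : tup M G) : same_tp a (tup_map a).
Proof. by move=> phi; exact: sat_aut. Qed.

End Automorphisms.

Section Indiscernibles.
Variable L : language.
Implicit Types (M N : structure L).

Definition incr n (f : 'I_n -> nat) := forall i j : 'I_n, (i < j)%N -> (f i < f j)%N.

(** The parameters form a tuple instead of a set, so that the property moves between [C] and [N],
    and along automorphisms, by an equality of types. *)
Definition indisc M (B : ctx L) (beta : tup M B) G (c : nat -> tup M G) : Prop :=
  forall n (f g : 'I_n -> nat), incr f -> incr g ->
    same_tp (tup_cat (flat (fun i => c (f i))) beta) (tup_cat (flat (fun i => c (g i))) beta).

(** The values of [u] may come unordered and repeated. Sorted and listed once, they form an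
    increasing tuple, which [pi] carries to an increasing tuple of the values of [v]. *)
Lemma indisc_iso M B (beta : tup M B) G (c : nat -> tup M G) (X : finType) (u v : X -> nat) :
  indisc beta c -> (forall x y, (u x < u y)%N = (v x < v y)%N) ->
  same_tp (tup_cat (flat (fun x => c (u x))) beta) (tup_cat (flat (fun x => c (v x))) beta).
Proof.
move=> cI uv.
have uvE x y : u x = u y -> v x = v y.
  by move=> E; apply/eqP; rewrite eqn_leq leqNgt [X in _ && X]leqNgt -!uv E ltnn.
pose U := sort leq (undup (codom u)).
pose pi z := odflt 0 (omap v [pick x | u x == z]).
have piE x : pi (u x) = v x.
  by rewrite /pi; case: pickP => [y /eqP/uvE //|/(_ x)]; rewrite eqxx.
have memU z : (z \in U) = (z \in codom u) by rewrite mem_sort mem_undup.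
have sU : sorted ltn U.
  by rewrite ltn_sorted_uniq_leq sort_uniq undup_uniq sort_sorted //; exact: leq_total.
pose f (i : 'I_(size U)) := nth 0 U i.
have fi : incr f by move=> i j ij; apply: (sorted_ltn_nth ltn_trans) => //; exact: ltn_ord.
have fU i : exists x, f i = u x.
  by apply/codomP; rewrite -memU mem_nth.
have gi : incr (fun i => pi (f i)).
  move=> i j /fi; have [x ->] := fU i; have [y ->] := fU j.
  by rewrite !piE uv.
apply: same_tp_ren (cI _ _ _ fi gi) _ => -[[x w]|w]; last first.
  by exists (Var (inr w : vars (ctx_cat (ctx_pow 'I_(size U) G) B))).
have xU : (index (u x) U < size U)%N by rewrite index_mem memU codom_f.
exists (Var (inl (Ordinal xU, w) : vars (ctx_cat (ctx_pow 'I_(size U) G) B))).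
by rewrite /= /flat /f /= nth_index ?memU ?codom_f // piE.
Qed.

Lemma indisc_block M B (beta : tup M B) G (c : nat -> tup M G) (X : finType)
    (F : nat -> X -> nat) :
  indisc beta c ->
  (forall j j' x x', (j < j')%N -> (F j x < F j' x')%N) ->
  (forall j j' x x', (F j x < F j x')%N = (F j' x < F j' x')%N) ->
  indisc beta (fun j => flat (fun x => c (F j x))).
Proof.
move=> cI F1 F2 n f g fi gi.
(* Positions in different blocks compare like the blocks, positions in one block as in block 0; so
   [f] and [g] induce the same order on all positions. *)
have key (k : 'I_n -> nat) (i i' : 'I_n) x x' : incr k ->
    (F (k i) x < F (k i') x')%N = (i < i')%N || (i == i') && (F 0 x < F 0 x')%N.
  move=> ki; case: (ltngtP i i') => [ii'|ii'|/val_inj ->] /=.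
  - exact/F1/ki.
  - rewrite -val_eqE /= gtn_eqF //=; apply/negbTE; rewrite -leqNgt.
    exact/ltnW/F1/ki.
  - by rewrite eqxx; exact: F2.
have H := indisc_iso (u := fun z : 'I_n * X => F (f z.1) z.2)
  (v := fun z : 'I_n * X => F (g z.1) z.2) cI.
apply: same_tp_ren (H _) _ => [z z'|[[i [x w]]|w]].
- by rewrite !key.
- by exists (Var (inl ((i, x), w) : vars (ctx_cat (ctx_pow ('I_n * X) G) B))).
- by exists (Var (inr w : vars (ctx_cat (ctx_pow ('I_n * X) G) B))).
Qed.

Lemma indisc_ren M B (beta : tup M B) G (c : nat -> tup M G)
    B' (beta' : tup M B') G' (c' : nat -> tup M G') :
  indisc beta c ->
  (forall v : vars G', exists t : term (ctx_cat G B) (srt v),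
     forall j, eval (tup_cat (c j) beta) t = c' j v) ->
  (forall v : vars B', exists t : term B (srt v), eval beta t = beta' v) ->
  indisc beta' c'.
Proof.
move=> cI H1 H2 n f g fi gi.
apply: same_tp_ren (cI _ _ _ fi gi) _ => -[[i w]|w].
  have [t Ht] := H1 w.
  pose sg (v : vars (ctx_cat G B)) :=
     match v return term (ctx_cat (ctx_pow 'I_n G) B) (srt (v : vars (ctx_cat G B))) with
     | inl v => Var (inl (i, v) : vars (ctx_cat (ctx_pow 'I_n G) B))
     | inr v => Var (inr v : vars (ctx_cat (ctx_pow 'I_n G) B)) end.
  have E (k : 'I_n -> nat) : (fun v => eval (tup_cat (flat (fun i => c (k i))) beta) (sg v))
      = tup_cat (c (k i)) beta.
    by apply: funextD => -[].
  by exists (tsub sg t); rewrite !eval_tsub !E !Ht.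
have [t Ht] := H2 w.
exists (tsub (fun v => Var (inr v : vars (ctx_cat (ctx_pow 'I_n G) B))) t).
by rewrite !eval_tsub /=.
Qed.

Lemma indisc_same_tp M N B (beta : tup M B) (beta' : tup N B) G
    (c : nat -> tup M G) (c' : nat -> tup N G) :
  same_tp (tup_cat (flat c) beta) (tup_cat (flat c') beta') ->
  indisc beta c -> indisc beta' c'.
Proof.
move=> E cI n f g fi gi.
have H (k : 'I_n -> nat) : same_tp (tup_cat (flat (fun i => c (k i))) beta)
    (tup_cat (flat (fun i => c' (k i))) beta').
  apply: same_tp_ren E _ => -[[i w]|w].
    by exists (Var (inl (k i, w) : vars (ctx_cat (ctx_pow nat G) B))).
  by exists (Var (inr w : vars (ctx_cat (ctx_pow nat G) B))).
apply: same_tp_trans (same_tp_sym (H f)) _.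
exact: same_tp_trans (cI _ _ _ fi gi) (H g).
Qed.

End Indiscernibles.

(** * Dependence in terms of finite patterns *)

Section NIP.
Variables (L : language) (T : theory L) (K : Type) (N : structure L).
Hypotheses (T_dep : dependent T) (N_models : models N T).
Hypotheses (natK : card_lt [set: nat] K) (satN : saturated K N).

(** [has_IP] asks for every subset of [nat] and for finite tuples on both sides. Saturation passes
    from finite patterns to all subsets, and [chi] uses the same finitely many coordinates of each
    [Y i]. *)
Lemma dependent_no_pattern n (s : 'I_n -> lsort L) G
    (chi : formula (ctx_cat (fctx s) G)) (Y : nat -> tup N G) :
  ~ (forall m (w : nat -> Prop), exists x : tup N (fctx s),
       forall i, (i < m)%N -> sat chi (tup_cat x (Y i)) <-> w i).
Proof.
move=> pat; have [m [f [chi' Hchi]]] := formula_support_right chi.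
pose G' := ctx_pow nat (sub_ctx f).
pose y : tup N G' := flat (fun i => tup_sub f (Y i)).
have /(_ _)/cid ps i : exists psi : formula (ctx_cat (fctx s) G'), forall x : tup N (fctx s),
    sat psi (tup_cat x y) <-> sat chi (tup_cat x (Y i)).
  exists (fsub chi' (fun v : vars (ctx_cat (fctx s) (sub_ctx f)) =>
     match v return term (ctx_cat (fctx s) G') (srt (v : vars (ctx_cat (fctx s) (sub_ctx f)))) with
     | inl v => Var (inl v : vars (ctx_cat (fctx s) G'))
     | inr v => Var (inr (i, v) : vars (ctx_cat (fctx s) G')) end)) => x.
  rewrite sat_fsub Hchi (_ : (fun v => _) = tup_cat x (tup_sub f (Y i))) //.
  by apply: funextD => -[].
have /choice[b Hb] : forall w : set nat, exists x : tup N (fctx s),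
    forall i, sat chi (tup_cat x (Y i)) <-> w i.
  move=> w.
  pose p : set (formula (ctx_cat (fctx s) G')) := [set psi | exists i,
    psi = if `[< w i >] then sval (ps i) else FNeg (sval (ps i))].
  have [| |l lp|x Hx] := saturated_realizes natK satN (y := y) (p := p).
  - apply: card_le_lt natK.
    by apply: (@inj_card_leT _ _ pickle : injective (pickle : nat * 'I_m -> nat) -> _); exact: pcan_inj (@pickleK _).
  - exact: finite_ctx_fin.
  - have [k Hk] : exists k, forall psi, List.In psi l -> exists2 i, (i < k)%N &
        psi = if `[< w i >] then sval (ps i) else FNeg (sval (ps i)).
      elim: l lp => [|psi l IH] lp; first by exists 0.
      have [k Hk] := IH (fun psi' H => lp psi' (or_intror H)).
      have [i Hi] := lp psi (or_introl erefl).
      exists (maxn i.+1 k) => _ [<-|/Hk[j jk ->]].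
        by exists i; rewrite ?leq_max ?ltnSn.
      by exists j; rewrite ?leq_max ?jk ?orbT.
    have [x Hx] := pat k w; exists x => psi /Hk[i ik ->].
    case: asboolP => wi; first by rewrite (svalP (ps i)) Hx.
    by move=> /=; rewrite (svalP (ps i)) Hx.
  - exists x => i; split=> [H|wi].
      apply: contrapT => wi.
      have /Hx : p (FNeg (sval (ps i))) by exists i; case: asboolP.
      by move=> /=; rewrite (svalP (ps i)).
    have /Hx : p (sval (ps i)) by exists i; case: asboolP.
    by rewrite (svalP (ps i)).
(* In [has_IP] the sequence stands on the left, so the two groups of variables are exchanged. *)
have [|chi2 H2] := @fsub_exists _ _ (ctx_cat (fctx (fun i => srt (f i))) (fctx s)) chi'
    (fun M => tup M (sub_ctx f) * tup M (fctx s))%type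
    (fun M z => @tup_cat _ _ (sub_ctx f) _ z.1 z.2) (fun M z => tup_cat z.2 z.1).
  move=> [v|v]; first by exists (Var (inr v : vars (ctx_cat (sub_ctx f) (fctx s)))).
  by exists (Var (inl v : vars (ctx_cat (sub_ctx f) (fctx s)))).
apply: (T_dep (phi := chi2) N_models).
exists (fun i => tup_sub f (Y i)), b => i w.
by rewrite (H2 N (tup_sub f (Y i), b w)) /= -Hchi.
Qed.

End NIP.

(** * Types that do not divide *)

Section Types.
Variables (L : language) (N : structure L).

Lemma rng_enum_tup (B : set (elt N)) : rng (enum_tup (B := B)) = B.
Proof.
apply/seteqP; split=> [_ [x _ <-]|x Bx] /=.
  by case: x => -[s x] Bx.
by exists (exist _ x Bx) => //; rewrite /enum_tup /=; case: x Bx.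
Qed.

Lemma tp_same_tp (B : set (elt N)) G (c c' : tup N G) :
  realizes c' (tp c B) <->
  same_tp (tup_cat c (enum_tup (B := B))) (tup_cat c' (enum_tup (B := B))).
Proof.
split=> [H|H th [thB Hth]].
  apply: same_tp_imp => psi.
  have [th [thB Hth]] := formula_pform psi (enum_tup (B := B)).
  rewrite -!Hth => Hc; apply: H; split=> //.
  by rewrite /over_params -[X in _ `<=` X]rng_enum_tup.
have [|psi Hpsi] := @pform_formula _ _ _ _ (enum_tup (B := B)) th.
  by rewrite rng_enum_tup.
by move: Hth; rewrite !Hpsi; move/(H psi).
Qed.

Lemma same_tp_eq_tp (B : set (elt N)) G (c c' : tup N G) :
  same_tp (tup_cat c (enum_tup (B := B))) (tup_cat c' (enum_tup (B := B))) ->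
  tp c B = tp c' B.
Proof.
move=> H; apply/seteqP; split=> th Hth; split; try by case: Hth.
  by move: Hth; apply: (tp_same_tp B c c').2.
by move: Hth; apply: (tp_same_tp B c' c).2; exact: same_tp_sym.
Qed.

Lemma indiscernible_indisc (B : set (elt N)) d (O : orderType d) G (I : O -> tup N G)
    (rho : nat -> O) :
  (forall i j, (i < j)%N -> (rho i < rho j)%O) ->
  indiscernible B I -> indisc (enum_tup (B := B)) (fun i => I (rho i)).
Proof.
move=> rhoI [_ _ H] n f g fi gi; apply/tp_same_tp => th.
rewrite (H n (rho \o f) (rho \o g)); first by move=> [].
  by move=> i j; rewrite ltEord => /fi/rhoI.
by move=> i j; rewrite ltEord => /gi/rhoI.
Qed.

Lemma indisc_indiscernible (B : set (elt N)) G (I : nat -> tup N G) :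
  indisc (enum_tup (B := B)) I -> indiscernible B I.
Proof.
move=> H; split.
- exact: infinite_nat.
- by move=> i; exists i.+1; rewrite ltEnat /=.
- by move=> n f g fi gi; apply: same_tp_eq_tp; apply: H => i j ij;
    [move: (fi i j)|move: (gi i j)]; rewrite ltEord ltEnat; apply.
Qed.

(** The formula chi(x, y, A) belongs to tp(z/B), so it does not divide over [A], and [Y] would
    witness dividing if finitely many instances had no common solution. *)
Lemma nondividing_consistent (A B : set (elt N)) G' G (z : tup N G') (y : tup N G)
    (chi : formula (ctx_cat G' (ctx_cat G (enum_ctx A)))) (Y : nat -> tup N G) :
  ~ divides A (tp z B) -> A `<=` B -> rng y `<=` B ->
  sat chi (tup_cat z (tup_cat y (enum_tup (B := A)))) ->
  indisc (enum_tup (B := A)) Y ->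
  (forall j, same_tp (tup_cat (Y j) (enum_tup (B := A))) (tup_cat y (enum_tup (B := A)))) ->
  forall n, exists z' : tup N G', forall j, (j < n)%N ->
    sat chi (tup_cat z' (tup_cat (Y j) (enum_tup (B := A)))).
Proof.
move=> nd AB yB Hz Yi Yy n; apply: contrapT => no; apply: nd.
have [m [f [chi' Hchi]]] := formula_support_right chi.
(* A dividing formula has a finite parameter tuple. Its coordinates from [A] stay constant along
   [I], which keeps indiscernibility over [A]. *)
pose I j : tup N (sub_ctx f) := tup_sub f (tup_cat (Y j) (enum_tup (B := A))).
pose par : tup N (sub_ctx f) := tup_sub f (tup_cat y (enum_tup (B := A))).
pose th := @PForm L N G' m (fun i => srt (f i)) chi' par.
exists th; split; last first.
  move=> x; apply; split; last by rewrite /holds /= -Hchi.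
  move=> _ [i _ <-] /=; rewrite /par /tup_sub; case: (f i) => [v|v].
    by apply: yB; exists v.
  by apply: AB; rewrite -[X in X _](rng_enum_tup A); exists v.
exists I; split.
- apply: indisc_indiscernible; apply: indisc_ren Yi _ _ => v; last by exists (Var v).
  by exists (Var (f v)).
- move=> j; apply/tp_same_tp; apply: same_tp_ren (same_tp_sym (Yy j)) _ => -[v|v].
    by exists (Var (f v)).
  by exists (Var (inr v : vars (ctx_cat G (enum_ctx A)))).
- move=> cons; apply: no.
  have [z' Hz'] : exists z', realizes z'
      ((fun j => @PForm L N G' m (fun i => srt (f i)) chi' (I j)) @` [set j | (j < n)%N]).
    apply: cons; first by apply: finite_image; exact: finite_II.
    by move=> _ [j _ <-]; exists j.
  exists z' => j jn; have : holds z' (@PForm L N G' m (fun i => srt (f i)) chi' (I j)).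
    by apply: Hz'; exists j.
  by rewrite /holds /= -Hchi.
Qed.

End Types.

(** * Nondividing types preserve indiscernible sequences *)

Section Extension.
Variables (L : language) (T : theory L).
Hypothesis T_dep : dependent T.
Variables (K' : Type) (C N : structure L).
Hypotheses (N_models : models N T) (natK' : card_lt [set: nat] K') (satN : saturated K' N).
Variables (emb : forall s, C s -> N s).
Hypothesis emb_elem : elementary_embedding emb.
Variable A : set (elt N).
Hypotheses (A_sub : A `<=` universe_of emb) (smallA : small_ctx K' (enum_ctx A)).
Variable alpha : tup C (enum_ctx A).

Definition emb_tup G (c : tup C G) : tup N G := fun v => emb (c v).

Hypothesis alphaE : emb_tup alpha = enum_tup (B := A).

Lemma emb_tup_same_tp G (c : tup C G) : same_tp c (emb_tup c).
Proof. exact: elementary_same_tp. Qed.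

Lemma emb_tup_cat G G' (c : tup C G) (c' : tup C G') :
  emb_tup (tup_cat c c') = tup_cat (emb_tup c) (emb_tup c').
Proof. by apply: funextD => -[]. Qed.

Lemma emb_tup_flat X G (c : X -> tup C G) : emb_tup (flat c) = flat (fun x => emb_tup (c x)).
Proof. by []. Qed.

Lemma emb_tup_universe G (c : tup C G) : rng (emb_tup c) `<=` universe_of emb.
Proof. by move=> _ [v _ <-]; exists (existT _ (srt v) (c v)). Qed.

Lemma indisc_emb G (c : nat -> tup C G) :
  indisc alpha c -> indisc (enum_tup (B := A)) (fun i => emb_tup (c i)).
Proof.
apply: indisc_same_tp; rewrite -alphaE -emb_tup_flat -emb_tup_cat.
exact: emb_tup_same_tp.
Qed.

Variables (n : nat) (t : 'I_n -> lsort L) (e : tup N (fctx t)).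
Hypothesis nd : ~ divides A (tp e (universe_of emb)).

Let aN := enum_tup (B := A).

(* If chi(e, d_0) and not chi(e, d_1), then the formula chi(x, d_0) /\ ~ chi(x, d_1)
   does not divide, so that chi alternates along the sequence d. *)
Lemma nondividing_indisc_step G (d : nat -> tup C G)
    (chi : formula (ctx_cat (fctx t) (ctx_cat G (enum_ctx A)))) :
  finite_ctx G -> indisc alpha d ->
  sat chi (tup_cat e (tup_cat (emb_tup (d 0)) aN)) ->
  sat chi (tup_cat e (tup_cat (emb_tup (d 1)) aN)).
Proof.
move=> finG di H0; apply: contrapT => H1.
pose dN i := emb_tup (d i).
have diN : indisc aN dN := indisc_emb di.
pose G2 := ctx_cat (fctx t) (ctx_cat (ctx_pow bool G) (enum_ctx A)).
have /(_ _)/cid part (b : bool) : exists psi : formula G2,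
    forall z : {M : structure L & tup M (fctx t) * (bool -> tup M G) * tup M (enum_ctx A)}%type,
    sat psi (tup_cat (projT2 z).1.1 (tup_cat (flat (projT2 z).1.2) (projT2 z).2)) <->
    sat chi (tup_cat (projT2 z).1.1 (tup_cat ((projT2 z).1.2 b) (projT2 z).2)).
  have [|psi Hpsi] := @fsub_exists _ _ G2 chi
     (fun M => tup M (fctx t) * (bool -> tup M G) * tup M (enum_ctx A))%type
     (fun M z => tup_cat z.1.1 (tup_cat (flat z.1.2) z.2))
     (fun M z => tup_cat z.1.1 (tup_cat (z.1.2 b) z.2)).
    move=> [v|[v|v]]; first by exists (Var (inl v : vars G2)).
      by exists (Var (inr (inl (b, v)) : vars G2)).
    by exists (Var (inr (inr v) : vars G2)).
  by exists psi => -[M z]; exact: (Hpsi M z).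
pose chi2 := FAnd (sval (part false)) (FNeg (sval (part true))).
have chi2E (x : tup N (fctx t)) (p : bool -> tup N G) :
    sat chi2 (tup_cat x (tup_cat (flat p) aN)) <->
    sat chi (tup_cat x (tup_cat (p false) aN)) /\ ~ sat chi (tup_cat x (tup_cat (p true) aN)).
  rewrite sat_and sat_neg.
  have := svalP (part false) (existT _ N (x, p, aN)).
  have := svalP (part true) (existT _ N (x, p, aN)).
  by move=> /= -> ->.
(* The consecutive pairs (d_{2j}, d_{2j+1}) form an indiscernible sequence in the type of (d_0,
   d_1). A common solution of [chi2] along them satisfies [chi] at even indices and fails it at odd
   ones. *)
have blk : indisc aN (fun j => flat (fun b : bool => dN (j.*2 + b)%N)).
  apply: (indisc_block (F := fun j (b : bool) => (j.*2 + b)%N)) diN _ _ => [j j' x x' jj'|j j' x x'].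
    have : (j.+1.*2 <= j'.*2)%N by rewrite leq_double.
    rewrite doubleS => h; apply: leq_trans (leq_trans h (leq_addr _ _)).
    by rewrite -addnS -addn2 leq_add2l; case: x.
  by rewrite !ltn_add2l.
have cons : forall m, exists x : tup N (fctx t), forall j, (j < m)%N ->
    sat chi2 (tup_cat x (tup_cat (flat (fun b : bool => dN (j.*2 + b)%N)) aN)).
  apply: (nondividing_consistent (y := flat (fun b : bool => dN b)) nd A_sub _ _ blk).
  - rewrite (_ : flat _ = emb_tup (flat (fun b : bool => d b))) //.
    exact: emb_tup_universe.
  - exact/chi2E.
  - move=> j; apply: (indisc_iso (u := fun b : bool => (j.*2 + b)%N) (v := fun b : bool => b : nat) diN).
    by move=> x y; rewrite ltn_add2l.
apply: (dependent_no_pattern (chi := chi) (Y := fun i => tup_cat (dN i) aN) T_dep N_models natK' satN).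
move=> m w; have [z Hz] := cons m.
(* Of pair [i] the even member is taken if [w i] holds and the odd one otherwise, so that [z] shows
   the pattern [w] along [u]. By indiscernibility some [x] shows it on the first [m] terms. *)
pose u (i : 'I_m) := (i.*2 + ~~ `[< w i >])%N.
have uE : same_tp (tup_cat (flat (fun i => dN (u i))) aN) (tup_cat (flat (fun i : 'I_m => dN i)) aN).
  apply: diN => i j ij //; have : (i.+1.*2 <= j.*2)%N by rewrite leq_double.
  rewrite doubleS => h; apply: leq_trans (leq_trans h (leq_addr _ _)).
  by rewrite /u -addnS -addn2 leq_add2l; case: (~~ _).
have sm : small_ctx K' (ctx_cat (ctx_pow 'I_m G) (enum_ctx A)).
  by apply: card_lt_countable_sum => //; apply: finite_ctx_countable; exact: finite_ctx_pow.
have [x Hx] := same_tp_amalgam natK' satN z sm (finite_ctx_fin t) uE.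
exists x => i im; have := Hz i im; rewrite chi2E addn0 addn1 => -[Hz0 Hz1].
pose i' := Ordinal im.
have E : same_tp (tup_cat z (tup_cat (dN (u i')) aN)) (tup_cat x (tup_cat (dN i) aN)).
  pose GG := ctx_cat (fctx t) (ctx_cat (ctx_pow 'I_m G) (enum_ctx A)).
  apply: same_tp_ren Hx _ => -[v|[v|v]].
  - by exists (Var (inl v : vars GG)).
  - by exists (Var (inr (inl (i', v)) : vars GG)).
  - by exists (Var (inr (inr v) : vars GG)).
rewrite -(E chi) /u /=; case: asboolP => wi /=; first by rewrite addn0.
by rewrite addn1.
Qed.

(** Two increasing tuples of indices may interleave, so both are compared with one tuple that lies
    beyond them. *)
Lemma nondividing_indisc G (c : nat -> tup C G) :
  finite_ctx G -> indisc alpha c ->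
  indisc (tup_cat e aN) (fun i => emb_tup (c i)).
Proof.
move=> finG ci m.
have far (f : 'I_m -> nat) S : incr f -> (forall i, (f i < S)%N) ->
    same_tp (tup_cat (flat (fun i => emb_tup (c (f i)))) (tup_cat e aN))
            (tup_cat (flat (fun i : 'I_m => emb_tup (c (S + i)%N))) (tup_cat e aN)).
  move=> fi fS.
  (* Block 0 is the given tuple, the later blocks are consecutive intervals of length [m] from [S]
     on; the previous lemma compares blocks 0 and 1. *)
  pose F j (i : 'I_m) := if j is j'.+1 then (S + j' * m + i)%N else f i.
  pose d j := flat (fun i : 'I_m => c (F j i)).
  have di : indisc alpha d.
    apply: (indisc_block (F := F)) ci _ _.
      move=> [|j] [|j'] x x' //= jj'; first by apply: leq_trans (fS x) _; rewrite -addnA leq_addr.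
      rewrite -!addnA ltn_add2l.
      apply: (@leq_trans (j.+1 * m)); first by rewrite mulSn addnC ltn_add2r.
      by apply: leq_trans (leq_addr _ _); rewrite leq_mul2r -ltnS jj' orbT.
    have fE x x' : (f x < f x')%N = (x < x')%N.
      case: (ltngtP x x') => [/fi //|/fi|/val_inj ->]; last by rewrite ltnn.
      by move=> h; apply/negbTE; rewrite -leqNgt ltnW.
    by move=> [|j] [|j'] x x' //=; rewrite ?fE ?ltn_add2l.
  apply: same_tp_imp => psi.
  pose G2 := ctx_cat (fctx t) (ctx_cat (ctx_pow 'I_m G) (enum_ctx A)).
  have [|chi Hchi] := @fsub_exists _ _ G2 psi
     (fun M => tup M (fctx t) * tup M (ctx_pow 'I_m G) * tup M (enum_ctx A))%type
     (fun M z => tup_cat z.1.1 (tup_cat z.1.2 z.2))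
     (fun M z => tup_cat z.1.2 (tup_cat z.1.1 z.2)).
    move=> [v|[v|v]]; first by exists (Var (inr (inl v) : vars G2)).
      by exists (Var (inl v : vars G2)).
    by exists (Var (inr (inr v) : vars G2)).
  have := nondividing_indisc_step (chi := chi) (finite_ctx_pow 'I_m finG) di.
  rewrite (Hchi N (e, emb_tup (d 0), aN)) (Hchi N (e, emb_tup (d 1), aN)).
  rewrite /d !emb_tup_flat /=.
  rewrite (_ : (fun i : 'I_m => emb_tup (c (S + 0 * m + i)%N)) = (fun i : 'I_m => emb_tup (c (S + i)%N))) //.
  by apply: funextD => i; rewrite mul0n addn0.
move=> f g fi gi.
pose S := (\max_i f i + \max_i g i).+1.
apply: same_tp_trans (far f S fi _) _.
  by move=> i; rewrite ltnS; apply: leq_trans (leq_addr _ _); exact: leq_bigmax.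
apply: same_tp_sym; apply: far gi _.
by move=> i; rewrite ltnS; apply: leq_trans (leq_addl _ _); exact: leq_bigmax.
Qed.

End Extension.

(** * Sequences finitely satisfiable in a given one *)

Section Coheir.
Variables (L : language) (K : Type) (M : structure L).
Hypotheses (natK : card_lt [set: nat] K) (satM : saturated K M).

(** Dependent choice with each term depending on all earlier ones: [acc m] holds the first [m]
    terms, padded with [x0]. *)
Lemma sequence_choice (X : Type) (P : forall m, ('I_m -> X) -> X -> Prop) :
  (forall m (b : 'I_m -> X), exists x, P m b x) ->
  exists b : nat -> X, forall m, P m (fun i : 'I_m => b i) (b m).
Proof.
move=> HP; have /(_ _ _)/cid H := HP.
have [x0 _] := HP 0 (fun i : 'I_0 => False_rect _ (notF (ltn_ord i))).
pose fix acc m : nat -> X := if m is m'.+1 then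
  (fun k => if k == m' then sval (H m' (fun i : 'I_m' => acc m' i)) else acc m' k)
  else fun=> x0.
pose b k := acc k.+1 k.
have accE m k : (k < m)%N -> acc m k = b k.
  elim: m => // m IH; rewrite ltnS leq_eqVlt => /predU1P[->//|km] /=.
  by rewrite (ltn_eqF km) IH.
exists b => m.
have -> : (fun i : 'I_m => b i) = (fun i : 'I_m => acc m i).
  by apply: funext => i; rewrite accE.
by rewrite /b /= eqxx; exact: svalP (H m _).
Qed.

Definition snoc (X : Type) m (x : 'I_m -> X) (y : X) (k : 'I_m.+1) : X :=
  oapp x y (unlift ord_max k).

Variables (G B D : ctx L) (c : nat -> tup M G) (dl : tup M D) (al : tup M B).
Hypotheses (finG : finite_ctx G) (smallDB : small_ctx K (ctx_cat D B)).

(* A Morley sequence of a global type that is finitely satisfiable in c. *)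
Lemma coheir_sequence : indisc al c ->
  exists b : nat -> tup M G,
  [/\ indisc (tup_cat dl al) b,
      forall j (chi : formula (ctx_cat G (ctx_cat D B))),
        (forall i, sat chi (tup_cat (c i) (tup_cat dl al))) ->
        sat chi (tup_cat (b j) (tup_cat dl al))
    & forall m, same_tp (tup_cat (flat (fun i : 'I_m => b i)) al)
                        (tup_cat (flat (fun i : 'I_m => c (m - i.+1)%N)) al)].
Proof.
move=> ci.
pose Gm := ctx_cat (ctx_pow nat G) (ctx_cat D B).
(* The sequence [c] joins the parameters, because terms of [b] will be replaced by terms of [c]
   while the other terms are compared over them. *)
pose gm : tup M Gm := tup_cat (flat c) (tup_cat dl al).
have [U [UU UF]] := ultraFilterLemma (frechet_properfilter infinite_nat).
have cG := finite_ctx_countable finG.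
have cnat : countable_type nat := countable_countType nat.
have [b Lim] : exists b : nat -> tup M G, forall m, ultra_tp U
    (fun i => tup_cat (c i) (tup_cat (flat (fun k : 'I_m => b k)) gm))
    (tup_cat (b m) (tup_cat (flat (fun k : 'I_m => b k)) gm)).
  apply: (@sequence_choice _ (fun m (b : 'I_m -> tup M G) x => ultra_tp U
    (fun i => tup_cat (c i) (tup_cat (flat b) gm)) (tup_cat x (tup_cat (flat b) gm)))).
  move=> m b; apply: (ultra_ext_tuple natK satM c UU) => //.
    apply: card_lt_countable_sum => //.
      by apply: finite_ctx_countable; exact: finite_ctx_pow.
    by apply: card_lt_countable_sum => //; exact: countable_prod.
  by move=> psi /filter_ex[].
have LimS m (f : 'I_m.+1 -> nat) : incr f -> ultra_tp U
    (fun i => tup_cat (flat (snoc (fun k => b (f (lift ord_max k))) (c i))) gm)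
    (tup_cat (flat (fun k => b (f k))) gm).
  move=> fi; pose GG := ctx_cat G (ctx_cat (ctx_pow 'I_(f ord_max) G) Gm).
  apply: ultra_tp_ren (Lim (f ord_max)) _ => -[[k w]|w]; last first.
    by exists (Var (inr (inr w) : vars GG)).
  rewrite /flat /snoc /=; case: unliftP => [j ->|->] /=.
    have jl : (f (lift ord_max j) < f ord_max)%N.
      by apply: fi; rewrite lift_max; exact: ltn_ord.
    by exists (Var (inr (inl (Ordinal jl, w)) : vars GG)).
  by exists (Var (inl w : vars GG)).
(* Induction on the length: the last term may be replaced by some [c i], which is part of [gm], and
   the remaining terms are then exchanged over [gm]. *)
have step m (f : 'I_m -> nat) : incr f ->
    same_tp (tup_cat (flat (fun k => b (f k))) gm) (tup_cat (flat (fun k : 'I_m => b k)) gm).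
  elim: m f => [|m IH] f fi.
    apply: same_tp_ren (same_tp_refl gm) _ => -[[[//]]|w].
    by exists (Var w).
  have vi : incr (fun k : 'I_m.+1 => k : nat) by [].
  have fi' : incr (fun k => f (lift ord_max k)).
    by move=> i j ij; apply: fi; rewrite !lift_max.
  apply: same_tp_imp => psi; rewrite (ultra_tpE _ UU (LimS _ f fi)) => H.
  apply: (LimS _ _ vi); apply: filterS H => i /=.
  have E : same_tp (tup_cat (flat (snoc (fun k => b (f (lift ord_max k))) (c i))) gm)
                   (tup_cat (flat (snoc (fun k => b (lift ord_max k)) (c i))) gm).
    apply: same_tp_ren (IH _ fi') _ => -[[k w]|w]; last first.
      by exists (Var (inr w : vars (ctx_cat (ctx_pow 'I_m G) Gm))).
    rewrite /flat /snoc /=; case: unliftP => [j _|_] /=.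
      exists (Var (inl (j, w) : vars (ctx_cat (ctx_pow 'I_m G) Gm))).
      by rewrite /= /flat /= /bump leqNgt ltn_ord.
    by exists (Var (inr (inl (i, w)) : vars (ctx_cat (ctx_pow 'I_m G) Gm))).
  by move/(E psi).
(* The last term of [b] is replaced first, by some [c i], and the earlier ones by terms of index
   above [i]; this reverses the order. The bound [l] carries the constraint, and can be met since
   [U] is nonprincipal. *)
have rev m : forall l (psi : formula (ctx_cat (ctx_pow 'I_m G) Gm)),
    sat psi (tup_cat (flat (fun k : 'I_m => b k)) gm) ->
    exists u : 'I_m -> nat, [/\ forall i j : 'I_m, (i < j)%N -> (u j < u i)%N,
      forall i, (l < u i)%N & sat psi (tup_cat (flat (fun k => c (u k))) gm)].
  elim: m => [|m IH] l psi.
    move=> H; exists (fun=> 0); split; try by case.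
    suff E : same_tp (tup_cat (flat (fun k : 'I_0 => b k)) gm) (tup_cat (flat (fun _ : 'I_0 => c 0)) gm).
      exact/(E psi).
    apply: same_tp_ren (same_tp_refl gm) _ => -[[[//]]|w].
    by exists (Var w).
  have vi : incr (fun k : 'I_m.+1 => k : nat) by [].
  rewrite (ultra_tpE _ UU (LimS _ _ vi)) => H.
  have Hl : U [set i | (l < i)%N].
    apply: UF; apply: sub_finite_set (finite_II l.+1) => i /= /negP.
    by rewrite -leqNgt.
  have [i [Hi li]] := filter_ex (filterI H Hl).
  have [|psi' Hpsi'] := @fsub_exists _ _ (ctx_cat (ctx_pow 'I_m G) Gm) psi
    (fun M => ('I_m -> tup M G) * tup M Gm)%type
    (fun M z => tup_cat (flat z.1) z.2)
    (fun M z => tup_cat (flat (snoc z.1 (fun w => z.2 (inl (i, w))))) z.2).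
    move=> [[k w]|w]; last by exists (Var (inr w : vars (ctx_cat (ctx_pow 'I_m G) Gm))).
    rewrite /flat /snoc /=; case: unliftP => [j _|_] /=.
      by exists (Var (inl (j, w) : vars (ctx_cat (ctx_pow 'I_m G) Gm))).
    by exists (Var (inr (inl (i, w)) : vars (ctx_cat (ctx_pow 'I_m G) Gm))).
  have [|u [u1 u2 u3]] := IH i psi'.
    rewrite (Hpsi' M (fun k : 'I_m => b k, gm)) /=.
    move: Hi => /=; congr (sat psi (tup_cat (flat (snoc _ _)) _)).
    by apply: funext => k; rewrite /bump leqNgt ltn_ord.
  exists (snoc u i); split.
  - move=> j k; rewrite /snoc; case: (unliftP ord_max j) => [j' ->|->];
      case: (unliftP ord_max k) => [k' ->|->]; rewrite ?lift_max /=.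
    + exact: u1.
    + by move=> _; exact: u2.
    + by move=> mk; have := ltn_ord k'; rewrite ltnNge ltnW.
    + by rewrite ltnn.
  - by move=> j; rewrite /snoc; case: unliftP => [j' _|_] //=; apply: ltn_trans (u2 j').
  - move: u3; rewrite (Hpsi' M (fun k => c (u k), gm)) /=.
    congr (sat psi (tup_cat (flat _) _)).
    by apply: funext => k; rewrite /snoc; case: unliftP.
exists b; split.
- move=> m f g fi gi.
  have H := same_tp_trans (step m f fi) (same_tp_sym (step m g gi)).
  apply: same_tp_ren H _ => -[v|v].
    by exists (Var (inl v : vars (ctx_cat (ctx_pow 'I_m G) Gm))).
  by exists (Var (inr (inr v) : vars (ctx_cat (ctx_pow 'I_m G) Gm))).
- move=> j chi H; pose GG := ctx_cat G (ctx_cat (ctx_pow 'I_j G) Gm).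
  have H' : ultra_tp U (fun i => tup_cat (c i) (tup_cat dl al)) (tup_cat (b j) (tup_cat dl al)).
    apply: ultra_tp_ren (Lim j) _ => -[v|v]; first by exists (Var (inl v : vars GG)).
    by exists (Var (inr (inr (inr v)) : vars GG)).
  by apply: H'; apply: filterS filterT => i _; exact: H.
- move=> m; apply: same_tp_imp => psi H.
  pose GG := ctx_cat (ctx_pow 'I_m G) Gm.
  have [|psi' Hpsi'] := @fsub_exists _ _ GG psi
    (fun M => tup M (ctx_pow 'I_m G) * tup M Gm)%type (fun M z => tup_cat z.1 z.2)
    (fun M z => tup_cat z.1 (fun v => z.2 (inr (inr v)))).
    move=> [v|v]; first by exists (Var (inl v : vars GG)).
    by exists (Var (inr (inr (inr v)) : vars GG)).
  have [|u [u1 _ u3]] := rev m 0 psi'.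
    by rewrite (Hpsi' M (flat (fun k : 'I_m => b k), gm)).
  move: u3; rewrite (Hpsi' M (flat (fun k => c (u k)), gm)) /=.
  have uE (x y : 'I_m) : (u x < u y)%N = (m - x.+1 < m - y.+1)%N.
    have -> : (m - x.+1 < m - y.+1)%N = (y < x)%N by rewrite ltn_sub2lE.
    case: (ltngtP y x) => [/u1 //|/u1 h|/val_inj ->]; last by rewrite ltnn.
    by apply/negbTE; rewrite -leqNgt ltnW.
  by move/(indisc_iso (u := u) (v := fun i : 'I_m => (m - i.+1)%N) ci uE psi).
Qed.

End Coheir.

(** * The array *)

Section Array.
Variables (L : language) (T : theory L).
Hypothesis T_dep : dependent T.
Variables (K K' : Type) (C N : structure L).
Hypotheses (natK : card_lt [set: nat] K) (satC : saturated K C)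
  (homC : strongly_homogeneous K C).
Hypotheses (N_models : models N T) (natK' : card_lt [set: nat] K') (satN : saturated K' N).
Variables (emb : forall s, C s -> N s).
Hypothesis emb_elem : elementary_embedding emb.
Variable A : set (elt N).
Hypotheses (A_sub : A `<=` universe_of emb) (smallA : small_ctx K (enum_ctx A))
  (smallA' : small_ctx K' (enum_ctx A)).
Variable alpha : tup C (enum_ctx A).
Notation E := (emb_tup emb).
Notation EA := (enum_ctx A).
Notation aN := (enum_tup (B := A)).
Hypothesis alphaE : E alpha = aN.

(** A link of Lascar distance at most one over [A]; chains of links preserve the Lascar strong
    type. *)
Definition indisc_pair G (x y : tup C G) : Prop :=
  exists s : nat -> tup C G, [/\ indisc alpha s, s 0 = x & s 1 = y].

Lemma indisc_pair_refl G (x : tup C G) : indisc_pair x x.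
Proof. by exists (fun=> x). Qed.

Lemma indisc_pair_same_tp G (x y : tup C G) :
  indisc_pair x y -> same_tp (tup_cat x alpha) (tup_cat y alpha).
Proof.
move=> [s [si <- <-]].
have H := indisc_iso (u := fun _ : unit => 0) (v := fun _ : unit => 1) si (fun _ _ => erefl).
apply: same_tp_ren H _ => -[v|v].
  by exists (Var (inl (tt, v) : vars (ctx_cat (ctx_pow unit G) EA))).
by exists (Var (inr v : vars (ctx_cat (ctx_pow unit G) EA))).
Qed.

Lemma indisc_pair_ren G G' (x y : tup C G) (x' y' : tup C G') :
  indisc_pair x y ->
  (forall v : vars G', exists t : term G (srt v), eval x t = x' v /\ eval y t = y' v) ->
  indisc_pair x' y'.
Proof.
move=> [s [si sx sy]] /(_ _)/cid H.
exists (fun j v => eval (s j) (sval (H v))); split.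
- apply: indisc_ren si _ _ => v; last by exists (Var v).
  exists (tsub (fun v : vars G => Var (inl v : vars (ctx_cat G EA))) (sval (H v))) => j.
  by rewrite eval_tsub.
- by apply: funextD => v; rewrite sx; case: (svalP (H v)).
- by apply: funextD => v; rewrite sy; case: (svalP (H v)).
Qed.

Lemma indisc_pair_aut (h : forall s, C s -> C s) G (x y : tup C G) :
  automorphism h -> tup_map h alpha = alpha ->
  indisc_pair x y -> indisc_pair (tup_map h x) (tup_map h y).
Proof.
move=> h_aut hal [s [si <- <-]].
exists (fun j => tup_map h (s j)); split=> //.
apply: indisc_same_tp si.
have := same_tp_aut h_aut (tup_cat (flat s) alpha).
rewrite (_ : tup_map h (tup_cat _ _) = tup_cat (flat (fun j => tup_map h (s j))) alpha) //.
by apply: funextD => -[//|v] /=; rewrite -[in RHS]hal.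
Qed.

Lemma homogeneous_over G (x y : tup C G) : finite_ctx G ->
  same_tp (tup_cat x alpha) (tup_cat y alpha) ->
  exists h : forall s, C s -> C s,
    [/\ automorphism h, tup_map h x = y & tup_map h alpha = alpha].
Proof.
move=> finG xy.
have [|h [h_aut hE]] := homC _ xy.
  by apply: card_lt_countable_sum => //; exact: finite_ctx_countable.
exists h; split=> //; apply: funextD => v; first exact: (hE (inl v)).
exact: (hE (inr v)).
Qed.

Variables (m : nat) (t : 'I_m -> lsort L).
Notation Tc := (fctx t).

(** The sequence through [x] and [y] stays indiscernible over [A] and [e], so [e] can be appended to
    all its terms. Saturation replaces [e] by some [e'] in [C], and an automorphism over [A] moves
    x, y, e' to x', y', f. *)
Lemma nondividing_indisc_pair G (x y x' y' : tup C G) (e : tup N Tc) (f : tup C Tc) :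
  finite_ctx G -> ~ divides A (tp e (universe_of emb)) -> indisc_pair x y ->
  same_tp (tup_cat (tup_cat x' (tup_cat y' f)) alpha)
          (tup_cat (tup_cat (E x) (tup_cat (E y) e)) aN) ->
  indisc_pair (tup_cat x' f) (tup_cat y' f).
Proof.
move=> finG nd [s [si sx sy]] xyf.
have eI := nondividing_indisc T_dep N_models natK' satN emb_elem A_sub smallA' alphaE nd finG si.
have cG := finite_ctx_countable finG.
have [||e' He'] := same_tp_amalgam natK satC (x := tup_cat (flat (fun i => E (s i))) aN)
  (y := tup_cat (flat s) alpha) e _ (finite_ctx_fin t) _.
- apply: card_lt_countable_sum => //; apply: countable_prod => //.
  exact: countable_countType.
- rewrite -alphaE -emb_tup_flat -emb_tup_cat; apply: same_tp_sym.
  exact: emb_tup_same_tp.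
pose GG := ctx_cat Tc (ctx_cat (ctx_pow nat G) EA).
have eI' : indisc (tup_cat e' alpha) s.
  apply: indisc_same_tp eI; apply: same_tp_ren He' _ => -[v|[v|v]].
  - by exists (Var (inr (inl v) : vars GG)).
  - by exists (Var (inl v : vars GG)).
  - by exists (Var (inr (inr v) : vars GG)).
have pe : indisc_pair (tup_cat x e') (tup_cat y e').
  exists (fun j => tup_cat (s j) e'); rewrite sx sy; split=> //.
  apply: indisc_ren eI' _ _ => v; last by exists (Var (inr v : vars (ctx_cat Tc EA))).
  case: v => v; first by exists (Var (inl v : vars (ctx_cat G (ctx_cat Tc EA)))).
  by exists (Var (inr (inl v) : vars (ctx_cat G (ctx_cat Tc EA)))).
have xye : same_tp (tup_cat (tup_cat x (tup_cat y e')) alpha)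
                   (tup_cat (tup_cat x' (tup_cat y' f)) alpha).
  apply: same_tp_trans (same_tp_sym xyf); apply: same_tp_sym.
  apply: same_tp_ren He' _ => -[[v|[v|v]]|v].
  - by rewrite -sx; exists (Var (inr (inl (0, v)) : vars GG)).
  - by rewrite -sy; exists (Var (inr (inl (1, v)) : vars GG)).
  - by exists (Var (inl v : vars GG)).
  - by exists (Var (inr (inr v) : vars GG)).
have [|h [h_aut hx hal]] := homogeneous_over _ xye.
  by do 2?[apply: finite_ctx_cat => //]; exact: finite_ctx_fin.
have := indisc_pair_aut h_aut hal pe.
have hE v : h _ (tup_cat x (tup_cat y e') v) = tup_cat x' (tup_cat y' f) v.
  by rewrite -hx.
congr indisc_pair; apply: funextD => -[v|v].
- exact: (hE (inl v)).
- exact: (hE (inr (inr v))).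
- exact: (hE (inr (inl v))).
- exact: (hE (inr (inr v))).
Qed.

Variables (a J : nat -> tup C Tc).
Hypotheses (J_ind : indisc alpha J)
  (J_tp : forall i j, same_tp (tup_cat (J j) alpha) (tup_cat (a i) alpha)).
Hypothesis ext : forall n, exists e : tup N Tc,
  [/\ ~ divides A (tp e (universe_of emb)),
      ~ divides A (tp (enum_tup (B := universe_of emb)) (A `|` rng e))
    & same_tp (tup_cat (tup_cat (flat (fun i : 'I_n => E (a i))) e) aN)
              (tup_cat (tup_cat (flat (fun i : 'I_n => E (a i))) (E (a n))) aN)].

(** [J] is an indiscernible sequence in tp(e/A), so by nondividing each formula true of [d] and [e]
    has common solutions along initial segments of [J]; saturation treats all formulas at once. *)
Lemma nondividing_copy H (d : tup C H) (e : tup N Tc) : finite_ctx H ->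
  ~ divides A (tp (enum_tup (B := universe_of emb)) (A `|` rng e)) ->
  (forall j, same_tp (tup_cat (E (J j)) aN) (tup_cat e aN)) ->
  exists d' : tup C H, forall (chi : formula (ctx_cat H (ctx_cat Tc EA))),
    sat chi (tup_cat (E d) (tup_cat e aN)) ->
    forall j, sat chi (tup_cat d' (tup_cat (J j) alpha)).
Proof.
move=> finH nd Je.
pose G := ctx_cat (ctx_pow nat Tc) EA.
pose y : tup C G := tup_cat (flat J) alpha.
pose p : set (formula (ctx_cat H G)) := [set psi | exists chi j,
  sat chi (tup_cat (E d) (tup_cat e aN)) /\
  forall x : tup C H, sat chi (tup_cat x (tup_cat (J j) alpha)) -> sat psi (tup_cat x y)].
have smallG : small_ctx K G.
  apply: card_lt_countable_sum => //; apply: countable_prod; exact: countable_countType.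
have [l lp|d' Hd'] := saturated_realizes natK satC (y := y) (p := p) smallG finH; last first.
  exists d' => chi Hchi j.
  have [|psi Hpsi] := @fsub_exists _ _ (ctx_cat H G) chi
    (fun M => tup M H * tup M G)%type (fun M z => tup_cat z.1 z.2)
    (fun M z => tup_cat z.1 (tup_cat (fun v => z.2 (inl (j, v))) (fun v => z.2 (inr v)))).
    move=> [v|[v|v]]; first by exists (Var (inl v : vars (ctx_cat H G))).
      by exists (Var (inr (inl (j, v)) : vars (ctx_cat H G))).
    by exists (Var (inr (inr v) : vars (ctx_cat H G))).
  apply/(Hpsi C (d', y)); apply: Hd'; exists chi, j; split=> // x Hx.
  exact/(Hpsi C (x, y)).
(* Finitely many conditions follow from one conjunction, asked along an initial segment of [J]. *)
have [chi [n [Hchi Hl]]] : exists (chi : formula (ctx_cat H (ctx_cat Tc EA))) n,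
    sat chi (tup_cat (E d) (tup_cat e aN)) /\
    forall x : tup C H, (forall j, (j < n)%N -> sat chi (tup_cat x (tup_cat (J j) alpha))) ->
      forall psi, List.In psi l -> sat psi (tup_cat x y).
  elim: l lp => [|psi l IH] lp; first by exists (FTop _), 0; split.
  have [chi [n [Hchi Hl]]] := IH (fun psi' h => lp psi' (or_intror h)).
  have [chi' [j [Hchi' Hj]]] := lp psi (or_introl erefl).
  exists (FAnd chi chi'), (maxn j.+1 n); split; first exact/sat_and.
  move=> x Hx psi' [<-|psi'l].
    by apply: Hj; have /sat_and[] := Hx j (leq_maxl _ _).
  apply: Hl psi'l => i ij.
  have ij' : (i < maxn j.+1 n)%N by rewrite leq_max ij orbT.
  by have /sat_and[] := Hx i ij'.
pose U := universe_of emb; pose EU := enum_ctx U.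
(* The nondividing type is that of the whole universe; [pt] locates [d] in its enumeration, and the
   copy is read off at these places. *)
pose pt (v : vars H) : vars EU :=
  exist _ (existT (fun s => N s) (srt v) (E d v))
    (ex_intro2 _ _ (existT _ (srt v) (d v)) I erefl : U _).
have [|chiU HchiU] := @fsub_exists _ _ (ctx_cat EU (ctx_cat Tc EA)) chi
    (fun M => tup M EU * tup M (ctx_cat Tc EA))%type (fun M z => tup_cat z.1 z.2)
    (fun M z => tup_cat (fun v => z.1 (pt v)) z.2).
  move=> [v|v]; first by exists (Var (inl (pt v) : vars (ctx_cat EU (ctx_cat Tc EA)))).
  by exists (Var (inr v : vars (ctx_cat EU (ctx_cat Tc EA)))).
have [||||z Hz] := @nondividing_consistent _ N A (A `|` rng e) _ _
  (enum_tup (B := U)) e chiU (fun j => E (J j)) nd _ _ _ _ Je n.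
- by move=> x Ax; left.
- by move=> x ex; right.
- by apply/(HchiU N (enum_tup (B := U), tup_cat e aN)).
- exact: (indisc_emb emb_elem alphaE).
have JE : same_tp (tup_cat (flat (fun j => E (J j))) aN) y.
  apply: same_tp_sym; rewrite -alphaE -emb_tup_flat -emb_tup_cat.
  exact: emb_tup_same_tp.
have [x Hx] := same_tp_amalgam natK satC (fun v => z (pt v)) smallG finH JE.
exists x; apply: Hl => j jn.
suff Ej : same_tp (tup_cat (fun v => z (pt v)) (tup_cat (E (J j)) aN))
    (tup_cat x (tup_cat (J j) alpha)).
  apply/(Ej chi)/(HchiU N (z, tup_cat (E (J j)) aN)); exact: Hz.
apply: same_tp_ren Hx _ => -[v|[v|v]].
- by exists (Var (inl v : vars (ctx_cat H G))).
- by exists (Var (inr (inl (j, v)) : vars (ctx_cat H G))).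
- by exists (Var (inr (inr v) : vars (ctx_cat H G))).
Qed.

Definition branch (D : nat -> nat -> tup C Tc) n (eta : nat -> nat) : tup C (ctx_pow 'I_n Tc) :=
  flat (fun l : 'I_n => D l (eta l)).
Arguments branch D n eta : clear implicits.

Definition zero_at i (eta : nat -> nat) l := if l == i then 0 else eta l.

(* The rows of D have the type of an initial segment of J, read backwards, and
   any two branches through D have the same Lascar strong type over A. *)
Definition array k n (D : nat -> nat -> tup C Tc) : Prop :=
  [/\ forall i, (i < n)%N -> D i 0 = a i,
      forall i, (i < n)%N ->
        same_tp (tup_cat (flat (fun j : 'I_k.+1 => D i j)) alpha)
                (tup_cat (flat (fun j : 'I_k.+1 => J (k.+1 - j.+1)%N)) alpha)
    & forall eta i, (forall l, (eta l < k.+1)%N) -> (i < n)%N ->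
        (forall l, (i < l)%N -> (l < n)%N -> eta l = 0) ->
        indisc_pair (branch D n (zero_at i eta)) (branch D n eta)].

Lemma array_step k n D : array k n D -> exists D', array k n.+1 D'.
Proof.
move=> [Da Db Dc]; have [e [nd1 nd2 ea]] := ext n.
pose HD := ctx_pow ('I_n * 'I_k.+1) Tc.
pose d : tup C HD := flat (fun z : 'I_n * 'I_k.+1 => D z.1 z.2).
have finT : finite_ctx Tc := finite_ctx_fin t.
have finHD : finite_ctx HD by exact: finite_ctx_pow.
have embA G (x : tup C G) : same_tp (tup_cat x alpha) (tup_cat (E x) aN).
  by rewrite -alphaE -emb_tup_cat; exact: emb_tup_same_tp.
have Je j : same_tp (tup_cat (E (J j)) aN) (tup_cat e aN).
  apply: same_tp_trans (same_tp_sym (embA _ _)) _.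
  apply: same_tp_trans (J_tp n j) _; apply: same_tp_trans (embA _ _) _.
  apply: same_tp_ren (same_tp_sym ea) _ => -[v|v].
    by exists (Var (inl (inr v) : vars (ctx_cat (ctx_cat (ctx_pow 'I_n Tc) Tc) EA))).
  by exists (Var (inr v : vars (ctx_cat (ctx_cat (ctx_pow 'I_n Tc) Tc) EA))).
have [d' Hd'] := nondividing_copy d finHD nd2 Je.
have [|b [bi bav brev]] := coheir_sequence natK satC d' finT _ J_ind.
  by apply: card_lt_countable_sum => //; exact: finite_ctx_countable.
(* A formula true of [d] and [e] holds of [d'] and every [J i], hence of [d'] and [b j], whose type
   over them is finitely satisfiable in [J]. *)
have de j : same_tp (tup_cat d' (tup_cat (b j) alpha)) (tup_cat (E d) (tup_cat e aN)).
  apply: same_tp_sym; apply: same_tp_imp => chi Hchi.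
  have [|chi' Hchi'] := @fsub_exists _ _ (ctx_cat Tc (ctx_cat HD EA)) chi
    (fun M => tup M HD * tup M Tc * tup M EA)%type
    (fun M z => tup_cat z.1.2 (tup_cat z.1.1 z.2)) (fun M z => tup_cat z.1.1 (tup_cat z.1.2 z.2)).
    move=> [v|[v|v]]; first by exists (Var (inr (inl v) : vars (ctx_cat Tc (ctx_cat HD EA)))).
      by exists (Var (inl v : vars (ctx_cat Tc (ctx_cat HD EA)))).
    by exists (Var (inr (inr v) : vars (ctx_cat Tc (ctx_cat HD EA)))).
  apply/(Hchi' C (d', b j, alpha)); apply: bav => i.
  by apply/(Hchi' C (d', J i, alpha)); exact: Hd'.
(* The old rows become their copy [d'], and [b] is row [n]. The first column then only has the type
   of the a_i; the automorphism [h] below puts the a_i themselves back. *)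
pose D1 i j : tup C Tc := if insub i is Some i' then fun w => d' ((i' : 'I_n, inord j), w) else b j.
have D1lt (i : 'I_n) j : D1 i j = fun w => d' ((i, inord j), w) by rewrite /D1 valK.
have D1n j : D1 n j = b j by rewrite /D1 insubN // -leqNgt.
pose GG := ctx_cat HD (ctx_cat Tc EA).
have col0 : same_tp (tup_cat (tup_cat (flat (fun i : 'I_n => D1 i 0)) (D1 n 0)) alpha)
                    (tup_cat (tup_cat (flat (fun i : 'I_n => a i)) (a n)) alpha).
  apply: (@same_tp_trans _ _ N _ _ _ (tup_cat (tup_cat (flat (fun i : 'I_n => E (a i))) e) aN)).
    apply: same_tp_ren (de 0) _ => -[[[i w]|w]|w].
    - exists (Var (inl ((i, inord 0), w) : vars GG)); rewrite /= /flat /= D1lt.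
      by rewrite /emb_tup /d /flat /= inordK // Da.
    - by exists (Var (inr (inl w) : vars GG)); rewrite /= D1n.
    - by exists (Var (inr (inr w) : vars GG)).
  apply: same_tp_trans ea _; apply: same_tp_sym; apply: same_tp_trans (embA _ _) _.
  by rewrite emb_tup_cat.
have [|h [h_aut hx hal]] := homogeneous_over _ col0.
  by apply: finite_ctx_cat => //; exact: finite_ctx_pow.
have hA G (x : tup C G) : same_tp (tup_cat (tup_map h x) alpha) (tup_cat x alpha).
  apply: same_tp_sym; apply: same_tp_trans (same_tp_aut h_aut _) _.
  rewrite (_ : tup_map h (tup_cat _ _) = tup_cat (tup_map h x) alpha) //.
  by apply: funextD => -[//|v] /=; rewrite -[in RHS]hal.
have ltn_case i : (i < n.+1)%N -> i = n \/ exists i' : 'I_n, i = i'.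
  rewrite ltnS leq_eqVlt => /predU1P[->|il]; first by left.
  by right; exists (Ordinal il).
exists (fun i j => tup_map h (D1 i j)); split.
- move=> i /ltn_case[->|[i' ->]]; apply: funextD => w.
    exact: (congr1 (fun f : tup C (ctx_cat (ctx_pow 'I_n Tc) Tc) => f (inr w)) hx).
  exact: (congr1 (fun f : tup C (ctx_cat (ctx_pow 'I_n Tc) Tc) => f (inl (i', w))) hx).
- move=> i /ltn_case[->|[i' ->]].
    rewrite (_ : flat _ = tup_map h (flat (fun j : 'I_k.+1 => b j))).
      by apply: same_tp_trans (hA _ _) _; exact: brev.
    by apply: funextD => -[j w]; rewrite /flat /tup_map /= D1n.
  rewrite (_ : flat _ = tup_map h (flat (fun j : 'I_k.+1 => D1 i' j))) //.
  apply: same_tp_trans (hA _ _) _; apply: same_tp_trans (Db i' (ltn_ord i')).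
  apply: (@same_tp_trans _ _ N _ _ _ (tup_cat (E (flat (fun j : 'I_k.+1 => D i' j))) aN));
    last by apply: same_tp_sym; exact: embA.
  apply: same_tp_ren (de 0) _ => -[[j w]|w]; last first.
    by exists (Var (inr (inr w) : vars GG)).
  by exists (Var (inl ((i', j), w) : vars GG)); rewrite /= /flat D1lt inord_val.
- move=> eta i etak il eta0.
  suff H : indisc_pair (branch D1 n.+1 (zero_at i eta)) (branch D1 n.+1 eta).
    exact: (indisc_pair_aut h_aut hal H).
  have branchE (xi : nat -> nat) (k' : 'I_n.+1) w : branch D1 n.+1 xi (k', w) =
      if unlift ord_max k' is Some j then d' ((j, inord (xi j)), w) else b (xi n) w.
    rewrite /branch /flat /=; case: unliftP => [j ->|->]; last by rewrite D1n.
    by rewrite lift_max D1lt.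
  case: (ltn_case i il) => [E1|[i' E1]].
    subst i; have [en0|en0] := posnP (eta n).
      rewrite (_ : zero_at n eta = eta); first exact: indisc_pair_refl.
      by apply: funext => l; rewrite /zero_at; case: eqP => // ->.
    (* Only the last row changes, along [b], which is indiscernible over [A] and [d']. The
       subsequence with indices 0, [eta n], [eta n + 1], ... starts with the two entries to be
       linked. *)
    pose g q := if q is q'.+1 then (eta n + q')%N else 0.
    have gi i j : (i < j)%N -> (g i < g j)%N.
      by case: i j => [|i] [|j] //=; rewrite ?addn_gt0 ?en0 // ltnS ltn_add2l.
    exists (fun q => branch D1 n.+1 (fun l => if l == n then g q else eta l)); split.
    + have bgi : indisc (tup_cat d' alpha) (fun q => b (g q)).
        by move=> q u v ui vi; apply: bi => x y xy; apply: gi; [exact: ui|exact: vi].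
      apply: indisc_ren bgi _ _ => v; last by exists (Var (inr v : vars (ctx_cat HD EA))).
      case: v => k' w.
      suff [tm Htm] : exists tm : term (ctx_cat Tc (ctx_cat HD EA)) (srt (w : vars Tc)),
        forall q, eval (tup_cat (b (g q)) (tup_cat d' alpha)) tm =
          if unlift ord_max k' is Some j then d' ((j, inord (eta j)), w) else b (g q) w.
        exists tm => q; rewrite branchE eqxx; apply: etrans (Htm q) _.
        by case: unliftP => // j _; rewrite (ltn_eqF (ltn_ord j)).
      case: unliftP => [j _|_].
        by exists (Var (inr (inl ((j, inord (eta j)), w)) : vars (ctx_cat Tc (ctx_cat HD EA)))).
      by exists (Var (inl w : vars (ctx_cat Tc (ctx_cat HD EA)))).
    + by congr branch; apply: funext => l.
    + by congr branch; apply: funext => l; rewrite /= addn0; case: eqP => // ->.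
  subst i; have en0 : eta n = 0 by apply: eta0.
  have P0 : indisc_pair (branch D n (zero_at i' eta)) (branch D n eta).
    by apply: Dc => // l il' ln; apply: eta0 => //; exact: ltnW.
  have finP : finite_ctx (ctx_pow 'I_n Tc) by exact: finite_ctx_pow.
  have zk l : (zero_at i' eta l < k.+1)%N by rewrite /zero_at; case: ifP.
  pose x' : tup C (ctx_pow 'I_n Tc) := branch D1 n (zero_at i' eta).
  pose y' : tup C (ctx_pow 'I_n Tc) := branch D1 n eta.
  (* The last row stays at [b 0], which relates to the copied rows as [e] to the old ones, so the
     old link extends. *)
  have P1 : indisc_pair (tup_cat x' (b 0)) (tup_cat y' (b 0)).
    apply: nondividing_indisc_pair finP nd1 P0 _.
    apply: same_tp_ren (de 0) _ => -[[[l w]|[[l w]|w]]|w].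
    + exists (Var (inl ((l, inord (zero_at i' eta l)), w) : vars GG)).
      by rewrite /= /x' /branch /flat /= D1lt /emb_tup /d /flat /= inordK.
    + exists (Var (inl ((l, inord (eta l)), w) : vars GG)).
      by rewrite /= /y' /branch /flat /= D1lt /emb_tup /d /flat /= inordK.
    + by exists (Var (inr (inl w) : vars GG)).
    + by exists (Var (inr (inr w) : vars GG)).
  apply: indisc_pair_ren P1 _ => -[k' w].
  have xE (xi : nat -> nat) : xi n = 0 -> branch D1 n.+1 xi (k', w) =
      if unlift ord_max k' is Some j then branch D1 n xi (j, w) else b 0 w.
    by move=> xin; rewrite branchE; case: unliftP => [j _|_]; rewrite ?xin // /branch /flat /= D1lt.
  rewrite xE; last by rewrite /zero_at gtn_eqF.
  rewrite xE //; case: unliftP => [j _|_].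
    by exists (Var (inl (j, w) : vars (ctx_cat (ctx_pow 'I_n Tc) Tc))).
  by exists (Var (inr w : vars (ctx_cat (ctx_pow 'I_n Tc) Tc))).
Qed.

Lemma array_exists k n : exists D, array k n D.
Proof.
elim: n => [|n [D /array_step//]].
by exists (fun _ _ => J 0); split.
Qed.

(** [et q] follows [eta] in the rows below [q] and is 0 from there on. Passing from [et q.+1] to
    [et q] resets row [q] while all later rows are at 0, as a link requires; [et 0] is the branch of
    the a_i. *)
Lemma array_branch k n D eta : array k n D -> (forall l, (eta l < k.+1)%N) ->
  same_tp (tup_cat (branch D n eta) alpha) (tup_cat (flat (fun i : 'I_n => a i)) alpha).
Proof.
move=> [Da _ Dc] etak.
pose et q l := if (l < q)%N then eta l else 0.
have H q : (q <= n)%N ->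
    same_tp (tup_cat (branch D n (et q)) alpha) (tup_cat (flat (fun i : 'I_n => a i)) alpha).
  elim: q => [_|q IH qn].
    rewrite (_ : branch D n _ = flat (fun i : 'I_n => a i)) //.
    by apply: funextD => -[i w]; rewrite /branch /flat /= Da.
  apply: same_tp_trans (IH (ltnW qn)); apply: same_tp_sym.
  rewrite (_ : et q = zero_at q (et q.+1)); last first.
    apply: funext => l; rewrite /zero_at /et ltnS.
    by case: (ltngtP l q).
  apply: indisc_pair_same_tp; apply: Dc => //.
    by move=> l; rewrite /et; case: ifP.
  by move=> l ql _; rewrite /et ltnNge ql.
rewrite (_ : branch D n eta = branch D n (et n)); first exact: H.
by apply: funextD => -[i w]; rewrite /branch /flat /= /et ltn_ord.
Qed.

End Array.

Arguments branch {L C m t} D n eta.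

(** * Reduction to sequences in [C] indexed by the natural numbers *)

Lemma increasing_sequence d (O : orderType d) :
  infinite_set [set: O] -> (forall i : O, exists j : O, (i < j)%O) ->
  exists rho : nat -> O, forall i j, (i < j)%N -> (rho i < rho j)%O.
Proof.
move=> /infinite_setN0[o _] /choice[f Hf].
exists (fun k => iter k f o) => i j; elim: j => // j IH.
rewrite ltnS leq_eqVlt => /predU1P[->|/IH h] /=; first exact: Hf.
exact: Order.POrderTheory.lt_trans h (Hf _).
Qed.

Lemma complete_type_realized (L : language) (N : structure L) (K : Type)
    (B : set (elt N)) (H : ctx L) (q : set (pform N H)) :
  card_lt [set: nat] K -> saturated K N -> small_ctx K (enum_ctx B) -> finite_ctx H ->
  complete_type B q -> exists e : tup N H, realizes e q.
Proof.
move=> natK satN smallB finH [qB qc _].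
pose p : set (formula (ctx_cat H (enum_ctx B))) := [set psi | exists th, q th /\
  forall x : tup N H, holds x th <-> sat psi (tup_cat x (enum_tup (B := B)))].
have [l lp|e He] := saturated_realizes natK satN (y := enum_tup (B := B)) (p := p) smallB finH; last first.
  exists e => th qth.
  have [|psi Hpsi] := @pform_formula _ N H _ (enum_tup (B := B)) th.
    by rewrite rng_enum_tup; exact: qB.
  by apply/Hpsi/He; exists th.
have [F [finF Fq HF]] : exists F : set (pform N H), [/\ finite_set F, F `<=` q &
    forall x, realizes x F -> forall psi, List.In psi l ->
      sat psi (tup_cat x (enum_tup (B := B)))].
  elim: l lp => [|psi l IH] lp.
    by exists set0; split=> //; exact: finite_set0.
  have [F [finF Fq HF]] := IH (fun psi' h => lp psi' (or_intror h)).
  have [th [qth Hth]] := lp psi (or_introl erefl).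
  exists (th |` F); split.
  - by rewrite finite_setU; split=> //; exact: finite_set1.
  - by move=> th' [->|/Fq].
  - move=> x Hx psi' [<-|]; first by apply/Hth/Hx; left.
    by apply: HF => th' Fth'; apply: Hx; right.
by have [x Hx] := qc F finF Fq; exists x; exact: HF.
Qed.

Lemma universe_lift (L : language) (C N : structure L) (emb : forall s, C s -> N s)
    (G : ctx L) (x : tup N G) :
  rng x `<=` universe_of emb -> exists c : tup C G, emb_tup emb c = x.
Proof.
move=> xU; have /(_ _)/cid H v : exists c : C (srt v), emb _ c = x v.
  have [c _ cE] : universe_of emb (existT _ (srt v) (x v)) by apply: xU; exists v.
  have : exists c : C (projT1 (existT (fun s => N s) (srt v) (x v))),
      emb _ c = projT2 (existT (fun s => N s) (srt v) (x v)).
    by rewrite -cE /=; eexists.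
  by [].
by exists (fun v => sval (H v)); apply: funextD => v; exact: (svalP (H v)).
Qed.

(** Finitely many indices, sorted, give a tuple of the same type over [A] as an initial segment
    along [rho]. If all these segments were consistent, so would be every finite set of
    instances. *)
Lemma inconsistent_initial_segment (L : language) (N : structure L) (K : Type)
    (A : set (elt N)) n (s : 'I_n -> lsort L) m (t : 'I_m -> lsort L)
    (phi : formula (ctx_cat (fctx s) (fctx t))) d (P : orderType d)
    (J : P -> tup N (fctx t)) (rho : nat -> P) :
  card_lt [set: nat] K -> saturated K N -> small_ctx K (enum_ctx A) ->
  indiscernible A J -> (forall i j, (i < j)%N -> (rho i < rho j)%O) ->
  ~ consistent (inst_seq phi J) ->
  exists k, ~ exists x : tup N (fctx s), forall j, (j < k)%N -> sat phi (tup_cat x (J (rho j))).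
Proof.
move=> natK satN smallA [_ _ JI] rhoI incons.
apply: contrapT => no; apply: incons => F finF FJ.
have [r Hr] : exists r : seq P, forall th, F th -> exists2 i, i \in r & th = PForm phi (J i).
  have [l Hl] := finite_set_In finF.
  suff [r Hr] : exists r : seq P, forall th, F th -> List.In th l ->
      exists2 i, i \in r & th = PForm phi (J i).
    by exists r => th Fth; apply: Hr => //; exact: Hl.
  move=> {Hl}; elim: l => [|th l [r Hr]]; first by exists [::].
  have [/FJ[i _ iE]|nF] := EM (F th).
    exists (i :: r) => th' Fth' [<-|/(Hr _ Fth')[j jr ->]].
      by exists i => //; rewrite mem_head.
    by exists j => //; rewrite in_cons jr orbT.
  by exists r => th' Fth' [E|]; [case: nF; rewrite E|exact: Hr].
pose U := sort <=%O (undup r); pose k := size U.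
have Us : sorted <%O U by rewrite Order.TotalTheory.sort_lt_sorted undup_uniq.
pose f (i : 'I_k) := nth (rho 0) U i.
have E : same_tp (tup_cat (flat (fun i : 'I_k => J (rho i))) (enum_tup (B := A)))
                 (tup_cat (flat (fun i => J (f i))) (enum_tup (B := A))).
  apply/tp_same_tp => th; rewrite (JI k (fun i => rho i) f); first by case.
    by move=> i j; rewrite ltEord => /rhoI.
  move=> i j; rewrite ltEord => ij.
  by apply: (sorted_ltn_nth (@Order.POrderTheory.lt_trans _ P)) => //; exact: ltn_ord.
have [x Hx] : exists x : tup N (fctx s), forall j, (j < k)%N -> sat phi (tup_cat x (J (rho j))).
  by apply: contrapT => h; apply: no; exists k.
have [|z Hz] := same_tp_amalgam natK satN x _ (finite_ctx_fin s) E.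
  apply: card_lt_countable_sum => //; apply: finite_ctx_countable.
  by apply: finite_ctx_pow; exact: finite_ctx_fin.
exists z => th /Hr[i ir ->].
have iU : (index i U < k)%N by rewrite index_mem mem_sort mem_undup.
pose j := Ordinal iU.
have fj : f j = i by rewrite /f nth_index // mem_sort mem_undup.
suff Ej : same_tp (tup_cat x (J (rho j))) (tup_cat z (J i)).
  exact/(Ej phi)/Hx.
pose GG := ctx_cat (fctx s) (ctx_cat (ctx_pow 'I_k (fctx t)) (enum_ctx A)).
apply: same_tp_ren Hz _ => -[v|v]; first by exists (Var (inl v : vars GG)).
by exists (Var (inr (inl (j, v)) : vars GG)); rewrite -fj.
Qed.

Theorem proposition4p9
  (L : language) (T : theory L)
  (T_complete : complete T) (T_dependent : dependent T) (T_eq : is_eq_closed T)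
  (* the monster model C and a larger monster model N *)
  (K K' : Type) (C N : structure L)
  (C_models : models C T) (C_monster : monster K C) (N_monster : monster K' N)
  (emb : forall s, C s -> N s) (emb_elem : elementary_embedding emb)
  (C_small : card_lt [set: elt C] K')
  (* A is a small subset of C *)
  (A : set (elt N))
  (A_sub : A `<=` universe_of emb) (A_small : card_lt A K)
  (* the formula phi(x, a) *)
  (n : nat) (s : 'I_n -> lsort L) (m : nat) (t : 'I_m -> lsort L)
  (phi : formula (ctx_cat (fctx s) (fctx t)))
  (a : tup N (fctx t)) (a_sub : rng a `<=` universe_of emb)
  (* the sequence J *)
  (dP : Order.disp_t) (P : orderType dP) (P_small : card_lt [set: P] K)
  (J : P -> tup N (fctx t)) (J_sub : forall i, rng (J i) `<=` universe_of emb)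
  (J_witness : witnesses_dividing A phi a J)
  (J_extendible : extendible (universe_of emb) A (tp (flat J) A))
  (a_strict : strictly_extendible (universe_of emb) A (tp a A))
  (* the strict Morley sequence I *)
  (dO : Order.disp_t) (O : orderType dO) (O_small : card_lt [set: O] K)
  (I : O -> tup N (fctx t)) (I_sub : forall i, rng (I i) `<=` universe_of emb)
  (I_Morley : strict_Morley_in (universe_of emb) A (tp a A) I) :
  ~ consistent (inst_seq phi I).
Proof.
have [K_big satC homC] := C_monster; have [K'_big satN _] := N_monster.
have natK : card_lt [set: nat] K.
  by apply: card_le_lt K_big; apply: (@inj_card_leT _ _ inr) => i j [].
have natK' : card_lt [set: nat] K'.
  by apply: card_le_lt K'_big; apply: (@inj_card_leT _ _ inr) => i j [].
have smallA : small_ctx K (enum_ctx A) by exact: card_lt_sig.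
have cardU : card_lt (universe_of emb) K' by exact: card_le_lt (card_le_range _) C_small.
have smallU : small_ctx K' (enum_ctx (universe_of emb)) by exact: card_lt_sig.
have smallA' : small_ctx K' (enum_ctx A).
  by apply: card_lt_sig; apply: card_le_lt cardU; exact: subset_card_le.
have N_models : models N T.
  move=> sigma /C_models; rewrite (elementary_same_tp (tup0 C) emb_elem).
  by congr (sat sigma _); apply: funextD => -[].
have [alpha alphaE] : exists alpha : tup C (enum_ctx A), emb_tup emb alpha = enum_tup (B := A).
  by apply: universe_lift; rewrite rng_enum_tup.
have embA G (x : tup C G) :
    same_tp (tup_cat x alpha) (tup_cat (emb_tup emb x) (enum_tup (B := A))).
  by rewrite -alphaE -emb_tup_cat; exact: emb_tup_same_tp.
have [J_ind J_tp J_incons] := J_witness.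
have [[I_ind I_free] I_tp] := I_Morley.
have [rho rhoI] : exists rho : nat -> P, forall i j, (i < j)%N -> (rho i < rho j)%O.
  by case: J_ind => h1 h2 _; exact: increasing_sequence.
have [ro roI] : exists ro : nat -> O, forall i j, (i < j)%N -> (ro i < ro j)%O.
  by case: I_ind => h1 h2 _; exact: increasing_sequence.
have [k Hk] := inconsistent_initial_segment natK' satN smallA' J_ind rhoI J_incons.
have /choice[Jc JcE] j : exists c : tup C (fctx t), emb_tup emb c = J (rho j).
  exact: universe_lift.
have /choice[ac acE] i : exists c : tup C (fctx t), emb_tup emb c = I (ro i).
  exact: universe_lift.
have Jc_ind : indisc alpha Jc.
  have := indiscernible_indisc rhoI J_ind; apply: indisc_same_tp; apply: same_tp_sym.
  apply: same_tp_trans (embA _ _) _.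
  rewrite (_ : emb_tup emb (flat Jc) = flat (fun i => J (rho i))) //.
  by apply: funextD => -[i w]; rewrite /flat /= -JcE.
have Jc_tp i j : same_tp (tup_cat (Jc j) alpha) (tup_cat (ac i) alpha).
  apply: same_tp_trans (embA _ _) _; apply: same_tp_sym.
  apply: same_tp_trans (embA _ _) _; rewrite JcE acE.
  by apply: same_tp_trans (same_tp_sym ((tp_same_tp _ _ _).1 (I_tp _))) _; apply/tp_same_tp.
have ext q : exists e : tup N (fctx t),
    [/\ ~ divides A (tp e (universe_of emb)),
        ~ divides A (tp (enum_tup (B := universe_of emb)) (A `|` rng e))
      & same_tp (tup_cat (tup_cat (flat (fun i : 'I_q => emb_tup emb (ac i))) e) (enum_tup (B := A)))
          (tup_cat (tup_cat (flat (fun i : 'I_q => emb_tup emb (ac i))) (emb_tup emb (ac q)))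
             (enum_tup (B := A)))].
  (* The strictly free type is over all earlier terms of [I], among them the [I (ro i)] with
     [i < q], so a realization [e] has the required type over these. *)
  have [p [pg pp pnd]] := I_free (ro q).
  have [e ep] := complete_type_realized natK' satN smallU (finite_ctx_fin t) pg.
  exists e; have [nd1 nd2] := pnd e ep; split=> //.
  have /tp_same_tp := fun th h => ep th (pp th h).
  set B := A `|` _ => EB.
  apply: same_tp_ren (same_tp_sym EB) _ => -[[[i w]|w]|w].
  - have Bi : B (existT (fun s => N s) (srt w) (emb_tup emb (ac i) w)).
      by right; rewrite acE; exists (ro i); [apply: roI; exact: ltn_ord|exists w].
    by exists (Var (inr (exist _ _ Bi) : vars (ctx_cat (fctx t) (enum_ctx B)))).
  - by exists (Var (inl w : vars (ctx_cat (fctx t) (enum_ctx B)))); rewrite /= acE.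
  - have Bw : B (sval w) by left; exact: (svalP w).
    by exists (Var (inr (exist _ _ Bw) : vars (ctx_cat (fctx t) (enum_ctx B)))).
move=> cons.
apply: (dependent_no_pattern (chi := phi) (Y := fun i => emb_tup emb (ac i))
  T_dependent N_models natK' satN) => q w.
have [x0 Hx0] : exists x : tup N (fctx s), forall i, (i < q)%N ->
    sat phi (tup_cat x (emb_tup emb (ac i))).
  have [|_ [i _ <-]|x Hx] := cons ((fun i => PForm phi (I (ro i))) @` [set i | (i < q)%N]).
  - by apply: finite_image; exact: finite_II.
  - by exists (ro i).
  - exists x => i iq; rewrite acE.
    by have : holds x (PForm phi (I (ro i))) by apply: Hx; exists i.
have [D HD] := array_exists T_dependent natK satC homC N_models natK' satN emb_elem
  A_sub smallA smallA' alphaE Jc_ind Jc_tp ext k q.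
have small_pow (X : finType) : small_ctx K' (ctx_cat (ctx_pow X (fctx t)) (enum_ctx A)).
  apply: card_lt_countable_sum => //; apply: finite_ctx_countable.
  by apply: finite_ctx_pow; exact: finite_ctx_fin.
(* If [x0] satisfied [phi] at every entry of row [i], a copy of [x0] would satisfy it at the first
   [k] terms of [J]. For [i >= q] the value 0 is a placeholder. *)
have /choice[jf Hjf] i : exists j, (j < k.+1)%N /\
    ((i < q)%N -> ~ sat phi (tup_cat x0 (emb_tup emb (D i j)))).
  have [iq|iq] := boolP (i < q)%N; last by exists 0.
  apply: contrapT => no; case: HD => _ Drow _; apply: Hk.
  have rowE : same_tp
      (tup_cat (flat (fun j : 'I_k.+1 => emb_tup emb (D i j))) (enum_tup (B := A)))
      (tup_cat (flat (fun j : 'I_k.+1 => emb_tup emb (Jc (k.+1 - j.+1)%N))) (enum_tup (B := A))).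
    apply: same_tp_trans (same_tp_sym (embA _ (flat (fun j : 'I_k.+1 => D i j)))) _.
    exact: same_tp_trans (Drow i iq) (embA _ _).
  have [x Hx] := same_tp_amalgam natK' satN x0 (small_pow _) (finite_ctx_fin s) rowE.
  exists x => j jk; rewrite -JcE.
  (* Entry [j'] of a row copies index [k - j'] of [J], so index [j] sits at entry [k - j]; entry 0
     copies index [k]. *)
  have jk' : (k - j < k.+1)%N by rewrite ltnS leq_subr.
  pose j' := Ordinal jk'.
  have -> : j = (k.+1 - j'.+1)%N by rewrite /= subSS subKn // ltnW.
  pose GG := ctx_cat (fctx s) (ctx_cat (ctx_pow 'I_k.+1 (fctx t)) (enum_ctx A)).
  suff Ej : same_tp (tup_cat x0 (emb_tup emb (D i j')))
                    (tup_cat x (emb_tup emb (Jc (k.+1 - j'.+1)%N))).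
    apply/(Ej phi); apply: contrapT => h; apply: no; exists j'; split=> //.
  apply: same_tp_ren Hx _ => -[v|v]; first by exists (Var (inl v : vars GG)).
  by exists (Var (inr (inl (j', v)) : vars GG)).
(* Entry 0 is a_i, where [x0] satisfies [phi], and entry [jf i] is one where it fails, so [x0] shows
   the pattern [w] along this branch. *)
pose eta i := if `[< w i >] then 0 else jf i.
have etak l : (eta l < k.+1)%N by rewrite /eta; case: ifP => // _; have [] := Hjf l.
have branchE : same_tp (tup_cat (flat (fun i : 'I_q => emb_tup emb (D i (eta i)))) (enum_tup (B := A)))
    (tup_cat (flat (fun i : 'I_q => emb_tup emb (ac i))) (enum_tup (B := A))).
  apply: same_tp_trans (same_tp_sym (embA _ (branch D q eta))) _.
  exact: same_tp_trans (array_branch HD etak) (embA _ _).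
have [x Hx] := same_tp_amalgam natK' satN x0 (small_pow _) (finite_ctx_fin s) branchE.
exists x => i iq; pose i' := Ordinal iq.
pose GG := ctx_cat (fctx s) (ctx_cat (ctx_pow 'I_q (fctx t)) (enum_ctx A)).
have Ei : same_tp (tup_cat x0 (emb_tup emb (D i (eta i)))) (tup_cat x (emb_tup emb (ac i))).
  apply: same_tp_ren Hx _ => -[v|v]; first by exists (Var (inl v : vars GG)).
  by exists (Var (inr (inl (i', v)) : vars GG)).
rewrite -(Ei phi) /eta; case: asboolP => wi.
  by case: HD => Da _ _; rewrite Da //; split=> // _; exact: Hx0.
by split=> // h; have [_ /(_ iq)] := Hjf i.
Qed.
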